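(* Let $F,G,K\in\mathbb C^{n\times n}$ with $G=G^H\ge 0$ and $K=K^H\ge 0$, and suppose that $(F,G)$ is controllable. Suppose that the algebraic Riccati equation $$F^H X+XF+XGX+K=0\qquad(\ast)$$ has a Hermitian solution $X_0$, and let $$H=\begin{bmatrix}F&G\\ -K&-F^H\end{bmatrix}$$ be the associated Hamiltonian matrix. Let $M\in\mathbb C^{n\times n}$ be an invertible matrix with $$M^{-1}(F+GX_0)M=\begin{bmatrix}T_1&0\\ 0&T_2\end{bmatrix},$$ where all eigenvalues of $T_1$ have nonzero real part and all eigenvalues of $T_2$ are purely imaginary. Partition conformably $$M^{-1}GM^{-H}=\begin{bmatrix}G_{11}&G_{21}^H\\ G_{21}&G_{22}\end{bmatrix},$$ let $Z_{12}$ be the unique solution of $T_1Z_{12}+Z_{12}T_2^H+G_{21}^H=0$, and put $$S=\begin{bmatrix}M&0\\ 0&M^{-H}\end{bmatrix}\begin{bmatrix}I&0&0&Z_{12}\\ 0&I&Z_{12}^H&0\\ 0&0&I&0\\ 0&0&0&I\end{bmatrix},$$ so that $H$ is transformed by the similarity transformation with $\begin{bmatrix}I&0\\ X_0&I\end{bmatrix}S$ to $$\begin{bmatrix}T_1&0&G_{11}&0\\ 0&T_2&0&G_{22}\\ 0&0&-T_1^H&0\\ 0&0&0&-T_2^H\end{bmatrix}.$$ Then there exists a block upper triangular symplectic matrix $$\widetilde Z=\begin{bmatrix}\widetilde Z_{11}&\widetilde Z_{12}\\ 0&\widetilde Z_{11}^{-H}\end{bmatrix}$$ such that $$\widetilde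 Z^{-1}\begin{bmatrix}T_2&G_{22}\\ 0&-T_2^H\end{bmatrix}\widetilde Z=\begin{bmatrix}\widetilde T&\widetilde G\\ 0&-\widetilde T^H\end{bmatrix},$$ where $$\widetilde T=\operatorname{diag}(N_1(\imath\gamma_1),\ldots,N_r(\imath\gamma_r)),\qquad \widetilde G=\operatorname{diag}(\widetilde G_1,\ldots,\widetilde G_r),$$ $N_j(\imath\gamma_j)$ is a Jordan block of size $k_j\times k_j$ associated with a purely imaginary eigenvalue $\imath\gamma_j$ ($\gamma_j\in\mathbb R$), and $\widetilde G_j=e_{k_j}e_{k_j}^H$ for $j=1,\ldots,r$, where $e_{k_j}$ is the $k_j$-th (last) column of the $k_j\times k_j$ identity matrix. Consequently, $\begin{bmatrix}T_2&G_{22}\\ 0&-T_2^H\end{bmatrix}$ and $H$ have the eigenvalues $\imath\gamma_1,\ldots,\imath\gamma_r$ (not necessarily distinct), with $\imath\gamma_j$ having a Jordan block of size $2k_j\times 2k_j$ for $j=1,\ldots,r$. In addition, let the columns of $\begin{bmatrix}U_{11}\\ U_{21}\end{bmatrix}$ span an arbitrary Lagrangian invariant subspace of $\begin{bmatrix}T_1&G_{11}\\ 0&-T_1^H\end{bmatrix}$. Then (with $U_{11}$ invertible) the equation $(\ast)$ has the corresponding solution $$X=X_0+M^{-H}\begin{bmatrix}U_{21}U_{11}^{-1}&0\\ 0&0\end{bmatrix}M^{-1}.$$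
   Context: $\imath=\sqrt{-1}$; $A^H$ is the conjugate transpose, $A^{-H}=(A^{-1})^H$. ''Purely imaginary'' eigenvalues are those with zero real part, including zero. $A\ge0$ means Hermitian positive semidefinite. Solutions of Riccati equations are understood to be Hermitian. A pair $(A,B)$ with $A\in\mathbb C^{n\times n}$, $B\in\mathbb C^{n\times m}$ is controllable if $\operatorname{rank}[\,sI-A\;\;B\,]=n$ for all $s\in\mathbb C$. Let $J=\begin{bmatrix}0&I\\ -I&0\end{bmatrix}$ (of the appropriate size). A matrix $H$ is Hamiltonian if $(JH)^H=JH$; a matrix $Z$ is symplectic if $Z^HJZ=J$. A Lagrangian invariant subspace of a $2m\times 2m$ Hamiltonian matrix $H$ is an $m$-dimensional subspace, spanned by the columns of a full column rank matrix $W\in\mathbb C^{2m\times m}$, with $HW=WT$ for some $T\in\mathbb C^{m\times m}$ and $W^HJW=0$. When written $W=\begin{bmatrix}U_{11}\\ U_{21}\end{bmatrix}$, the blocks $U_{11},U_{21}$ are $m\times m$. Jordan blocks $N_j(\imath\gamma_j)$ are upper triangular with $\imath\gamma_j$ on the diagonal and ones on the superdiagonal. The blocks $T_1$ or $T_2$ may be void. *)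

(* Defs.v *)
From mathcomp Require Import all_boot all_order all_algebra.
From mathcomp Require Export spectral sesquilinear.
From mathcomp Require Import complex reals.

Set Implicit Arguments.
Unset Strict Implicit.
Unset Printing Implicit Defensive.

Import Order.TTheory GRing.Theory Num.Theory Num.Def.
Local Open Scope ring_scope.
Local Open Scope sesquilinear_scope.

Definition psdmx (C : numClosedFieldType) n (A : 'M[C]_n) : Prop :=
  A \is hermsymmx /\ forall v : 'cV[C]_n, 0 <= (v^t* *m A *m v) 0 0.

Definition controllable (C : numClosedFieldType) n m
    (A : 'M[C]_n) (B : 'M[C]_(n, m)) : Prop :=
  forall s : C, \rank (row_mx (s%:M - A) B) = n.

Definition riccati_solution (C : numClosedFieldType) n
    (F G K X : 'M[C]_n) : Prop :=
  X \is hermsymmx /\ F^t* *m X + X *m F + X *m G *m X + K = 0.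

Definition riccati_hamiltonian (C : numClosedFieldType) n
    (F G K : 'M[C]_n) : 'M[C]_(n + n) :=
  block_mx F G (- K) (- F^t*).

Definition Jmx (C : numClosedFieldType) n : 'M[C]_(n + n) :=
  block_mx 0 1%:M (- 1%:M) 0.

Definition symplectic (C : numClosedFieldType) n (Z : 'M[C]_(n + n)) : Prop :=
  Z^t* *m Jmx C n *m Z = Jmx C n.

(* The subspace is the column span of W, not its MathComp row space. *)
Definition lagrangian_invariant (C : numClosedFieldType) m
    (H : 'M[C]_(m + m)) (W : 'M[C]_(m + m, m)) : Prop :=
  [/\ \rank W = m,
      exists T : 'M[C]_m, H *m W = W *m T
    & W^t* *m Jmx C m *m W = 0].

Definition jordan_block (C : numClosedFieldType) k (a : C) : 'M[C]_k :=
  \matrix_(i, j) (a *+ (i == j) + (i.+1 == j :> nat)%:R).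

Definition last_col (C : numClosedFieldType) k : 'cV[C]_k :=
  \col_i (i.+1 == k)%:R.

(* P and Q are mutually inverse, so m = n; keeping the two sizes syntactically
   distinct avoids casts when they are only provably equal. *)
Definition mx_similar (C : numClosedFieldType) m n
    (A : 'M[C]_m) (B : 'M[C]_n) : Prop :=
  exists (P : 'M[C]_(m, n)) (Q : 'M[C]_(n, m)),
    [/\ P *m Q = 1%:M, Q *m P = 1%:M & Q *m A *m P = B].

(* Main.v *)
(* Write A for the conjugate transpose of T2 and g for the semidefinite form of
   G22; controllability says that g is positive on the eigenvectors of A.
   A similarity by [[I, Y], [0, I]] with Y Hermitian replaces g by
   g + Y(A., .) + Y(., A.), so the condensed form is a Jordan basis of A and a
   Y for which the only nonzero values of the new form are 1 at (e, e), e the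
   last vector (the eigenvector) of a chain.  These are found by induction on
   the dimension.  For an eigenvalue lambda, restrict to the image W of
   A - lambda.  Every lambda-chain of W is lengthened by a preimage of its top
   vector, corrected by eigenvectors so that the one obstruction to extending
   Y vanishes, and g-orthonormal lambda-eigenvectors, g-orthogonal to those in
   W, are added as chains of length 1.  Since the eigenvalues are imaginary, the conditions on
   the new values of Y are then solved recursively along each old chain.
   In the condensed form, running up the basis of T and then down, with
   alternating signs, the dual basis of -T^H gives chains of length 2 k_j. *)

Require Import Defs.
From mathcomp Require Import all_boot all_order all_algebra.
From Stdlib Require Import Lia.
From mathcomp Require Import complex reals ring zify.

Set Implicit Arguments.
Unset Strict Implicit.
Unset Printing Implicit Defensive.

Import Order.TTheory GRing.Theory Num.Theory Num.Def.
Local Open Scope ring_scope.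
Local Open Scope sesquilinear_scope.

(** * Conjugate transposes and eigenvectors *)

Lemma adjmxM (C : numClosedFieldType) m n p (A : 'M[C]_(m, n)) (B : 'M_(n, p)) :
  (A *m B)^t* = B^t* *m A^t*.
Proof. by rewrite trmx_mul map_mxM. Qed.

Lemma adjmxD (C : numClosedFieldType) m n (A B : 'M[C]_(m, n)) :
  (A + B)^t* = A^t* + B^t*.
Proof. by rewrite linearD map_mxD. Qed.

Lemma adjmxN (C : numClosedFieldType) m n (A : 'M[C]_(m, n)) :
  (- A)^t* = - A^t*.
Proof. by rewrite linearN map_mxN. Qed.

Lemma adjmxZ (C : numClosedFieldType) m n a (A : 'M[C]_(m, n)) :
  (a *: A)^t* = a^* *: A^t*.
Proof. by rewrite linearZ map_mxZ. Qed.

Lemma adjmx0 (C : numClosedFieldType) m n : (0 : 'M[C]_(m, n))^t* = 0.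
Proof. by rewrite trmx0 map_mx0. Qed.

Lemma adjmx1 (C : numClosedFieldType) n : (1%:M : 'M[C]_n)^t* = 1%:M.
Proof. by rewrite trmx1 map_mx1. Qed.

Lemma adjmx_block (C : numClosedFieldType) m1 m2 n1 n2 (A : 'M[C]_(m1, n1))
    (B : 'M_(m1, n2)) (D : 'M_(m2, n1)) (E : 'M_(m2, n2)) :
  (block_mx A B D E)^t* = block_mx (A^t* ) (D^t* ) (B^t* ) (E^t* ).
Proof. by rewrite tr_block_mx map_block_mx. Qed.

Lemma adjmx_col (C : numClosedFieldType) m1 m2 n (A : 'M[C]_(m1, n))
    (B : 'M_(m2, n)) : (col_mx A B)^t* = row_mx (A^t* ) (B^t* ).
Proof. by rewrite tr_col_mx map_row_mx. Qed.

Lemma unitmx_adj (C : numClosedFieldType) n (A : 'M[C]_n) :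
  (A^t* \in unitmx) = (A \in unitmx).
Proof. by rewrite map_unitmx unitmx_tr. Qed.

Lemma adjmx_inv (C : numClosedFieldType) n (A : 'M[C]_n) :
  (invmx A)^t* = invmx (A^t* ).
Proof. by rewrite trmx_inv map_invmx. Qed.

Lemma hermsymmxP (C : numClosedFieldType) n (A : 'M[C]_n) :
  reflect (A^t* = A) (A \is hermsymmx).
Proof.
by apply: (iffP (is_hermitianmxP _ _ _)); rewrite expr0 scale1r => /esym.
Qed.

Lemma mx11_eq (C : pzRingType) (A B : 'M[C]_1) : A 0 0 = B 0 0 -> A = B.
Proof. by move=> e; rewrite [A]mx11_scalar [B]mx11_scalar e. Qed.

Lemma eigenvalue_colP (F : fieldType) n (A : 'M[F]_n) a :
  reflect (exists2 x : 'cV_n, A *m x = a *: x & x != 0) (eigenvalue A a).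
Proof.
have -> : eigenvalue A a = eigenvalue A^T a.
  rewrite /eigenvalue /eigenspace !kermx_eq0 !row_free_unit -unitmx_tr.
  by rewrite linearB /= tr_scalar_mx.
apply: (iffP eigenvalueP) => -[v e nz]; exists v^T.
- by apply: trmx_inj; rewrite trmx_mul linearZ /= trmxK.
- by rewrite trmx_eq0.
- by apply: trmx_inj; rewrite trmx_mul !trmxK linearZ /= trmxK e.
- by rewrite trmx_eq0.
Qed.

(** The kernel of [Q] is nonzero and stable under [A], so over an algebraically closed field the
    restriction of [A] to it has an eigenvector. Kernels are row spaces, so [B] is a basis of the
    transposed kernel, with [A^T] acting from the right. *)
Lemma kernel_eigenvector (C : numClosedFieldType) p n
    (Q : 'M[C]_(p, n)) (A : 'M_n) (x0 : 'cV_n) :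
  (forall x : 'cV_n, Q *m x = 0 -> Q *m (A *m x) = 0) ->
  Q *m x0 = 0 -> x0 != 0 ->
  exists (a : C) (x : 'cV_n), [/\ x != 0, Q *m x = 0 & A *m x = a *: x].
Proof.
move=> stab Qx0 x0nz; pose K := kermx Q^T; pose B := row_base K.
have KP (u : 'rV_n) : (u <= K)%MS -> Q *m u^T = 0.
  by move/sub_kermxP => e; apply: trmx_inj; rewrite trmx_mul trmxK e trmx0.
have KP' (u : 'rV_n) : Q *m u^T = 0 -> (u <= K)%MS.
  by move=> e; apply/sub_kermxP; rewrite -[u]trmxK -trmx_mul e trmx0.
have sB : (B *m A^T <= B)%MS.
  rewrite !eq_row_base; apply/row_subP => i; rewrite row_mul.
  apply: KP'; rewrite trmx_mul trmxK; apply: stab; apply: KP.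
  by rewrite (submx_trans (row_sub i B)) ?eq_row_base.
have r0 : (0 < \rank K)%N.
  rewrite lt0n mxrank_eq0; apply: contra_neq x0nz => K0.
  have := KP' x0^T; rewrite trmxK Qx0 K0 => /(_ erefl).
  by rewrite submx0 trmx_eq0 => /eqP.
have [a /eigenvalueP[v e vnz]] := eigenvalue_closed (B *m A^T *m pinvmx B) r0.
exists a, (v *m B)^T; split.
- by rewrite trmx_eq0 mulmx_free_eq0 // row_base_free.
- by apply: KP; rewrite (submx_trans (submxMl _ _)) ?eq_row_base.
- have e2 : v *m B *m A^T = a *: (v *m B).
    by rewrite -mulmxA -(mulmxKpV sB) mulmxA e scalemxAl.
  by apply: trmx_inj; rewrite [in LHS]trmx_mul trmxK e2 linearZ /= trmxK.
Qed.

Lemma injmx_left_inverse (F : fieldType) m n (A : 'M[F]_(m, n)) :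
  (forall x : 'cV_n, A *m x = 0 -> x = 0) -> exists B, B *m A = 1%:M.
Proof.
move=> inj; have fA : row_free A^T.
  apply/row_freeP; exists (pinvmx A^T); apply: mulmxVp.
  rewrite -kermx_eq0; apply/eqP/row_matrixP => i; rewrite row0.
  apply: trmx_inj; rewrite trmx0; apply: inj; apply: trmx_inj.
  by rewrite trmx_mul trmxK trmx0 -row_mul mulmx_ker row0.
have [B e] := row_freeP fA; exists B^T.
by apply: trmx_inj; rewrite trmx_mul trmxK e trmx1.
Qed.

Lemma big_tagnat (V : nmodType) r (k : 'I_r -> nat)
    (f : 'I_r -> nat -> V) :
  \sum_(s < \sum_j k j) f (tagnat.sig1 s) (tagnat.sig2 s) =
  \sum_j \sum_(i < k j) f j i.
Proof.
rewrite sig_big_dep /= (reindex _ tagnat.sig_bij_on) /=.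
by apply: eq_bigr.
Qed.

(** * Jordan chains *)

Lemma big_tagnat_block (V : nmodType) r (k : 'I_r -> nat) (j : 'I_r)
    (f : nat -> V) :
  \sum_(s < \sum_j k j)
     (if tagnat.sig1 s == j then f (tagnat.sig2 s) else 0) =
  \sum_(i < k j) f i.
Proof.
rewrite (big_tagnat _ (fun j' i => if j' == j then f i else 0)).
rewrite (bigD1 j) //= eqxx [X in _ + X]big1 ?addr0 // => j' /negPf ->.
by rewrite big1.
Qed.

Lemma sum_ord_eq (V : pzRingType) (k i : nat) (f : nat -> V) :
  \sum_(i' < k) (i' == i :> nat)%:R * f i' = if (i < k)%N then f i else 0.
Proof.
case: ltnP => [lt|le].
  rewrite (bigD1 (Ordinal lt)) //= eqxx mul1r big1 ?addr0 // => i' ne.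
  by rewrite -(inj_eq val_inj) /= in ne; rewrite (negPf ne) mul0r.
by rewrite big1 // => i' _; rewrite ltn_eqF ?mul0r // (leq_trans _ le).
Qed.

(** The entries are described by functions [b j] on natural numbers: positions in two blocks then
    compare without transporting ordinals along an equality of blocks. *)
Lemma mxdiagE (V : nmodType) r (k : 'I_r -> nat) (B : forall j, 'M[V]_(k j))
    (b : 'I_r -> nat -> nat -> V) s t :
  (forall j i i', B j i i' = b j i i') ->
  (\mxdiag_(j < r) B j) s t =
  if tagnat.sig1 s == tagnat.sig1 t
  then b (tagnat.sig1 s) (tagnat.sig2 s) (tagnat.sig2 t) else 0.
Proof.
move=> Bb; rewrite !mxE.
move: (tagnat.sig1 s) (tagnat.sig1 t) (tagnat.sig2 s) (tagnat.sig2 t).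
move=> j j' i i'; case: eqVneq i' => [<-|_] i'; last by rewrite mxE.
by rewrite conform_mx_id Bb.
Qed.

(** The predecessor of the bottom vector is 0, so that an eigenvector obeys the same chain equation
    as the vectors above it. *)
Definition prevv (V : nmodType) (f : nat -> V) i :=
  if i is i'.+1 then f i' else 0.

(* The chains are numbered from their eigenvector [E j 0] upwards, so that
   lengthening a chain does not renumber it. *)
Definition jordan_chains (C : numClosedFieldType) n (A : 'M[C]_n) r
    (k : 'I_r -> nat) (l : 'I_r -> C) (E : 'I_r -> nat -> 'cV[C]_n) :=
  forall j i, (i < k j)%N -> A *m E j i = l j *: E j i + prevv (E j) i.

Definition chain_mx (C : numClosedFieldType) n r (k : 'I_r -> nat)
    (E : 'I_r -> nat -> 'cV[C]_n) : 'M[C]_(n, \sum_j k j) :=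
  \matrix_(a, s) E (tagnat.sig1 s) (tagnat.sig2 s) a 0.

Lemma col_chain_mx (C : numClosedFieldType) n r (k : 'I_r -> nat)
    (E : 'I_r -> nat -> 'cV[C]_n) j (i : 'I_(k j)) :
  col (tagnat.Rank j i) (chain_mx k E) = E j i.
Proof.
by apply/colP => a; rewrite !mxE tagnat.Rank2K /= tagnat.Rank1K.
Qed.

Lemma mul_chain_mx (C : numClosedFieldType) n (A : 'M[C]_n) r
    (k : 'I_r -> nat) (l : 'I_r -> C) (E : 'I_r -> nat -> 'cV[C]_n) :
  jordan_chains A k l E ->
  A *m chain_mx k E =
  chain_mx k E *m \mxdiag_(j < r) jordan_block (k j) (l j).
Proof.
move=> ch; apply/matrixP => a t.
pose b (j : 'I_r) (i i' : nat) : C := l j *+ (i == i') + (i.+1 == i')%:R.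
have bE j (i i' : 'I_(k j)) : jordan_block (k j) (l j) i i' = b j i i'.
  by rewrite mxE.
have -> : (A *m chain_mx k E) a t = (A *m col t (chain_mx k E)) a 0.
  by rewrite !mxE; apply: eq_bigr => s _; rewrite !mxE.
rewrite -(tagnat.sig2K t); move: (tagnat.sig1 t) (tagnat.sig2 t) => j i.
rewrite col_chain_mx ch // !mxE.
pose f (i' : nat) : C := b j i' i * E j i' a 0.
transitivity (\sum_(i' < k j) f i').
  rewrite (eq_bigr (fun i' : 'I_(k j) => (i' == i :> nat)%:R * (l j * E j i' a 0)
      + (i'.+1 == i)%:R * E j i' a 0)); last first.
    by move=> i1 _; rewrite /f /b mulrDl !(mulrnAl, mulr_natl, mul1r).
  rewrite big_split /= (sum_ord_eq _ i (fun i' => l j * E j i' a 0)) ltn_ord.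
  clear f; congr (_ + _); case: i => [[|i] lt] /=.
    by rewrite mxE big1 // => i1 _; rewrite mul0r.
  by rewrite (sum_ord_eq _ i (fun i' => E j i' a 0)) (ltnW lt).
rewrite -big_tagnat_block; apply: eq_bigr => s _.
rewrite (mxdiagE _ _ bE) mxE tagnat.Rank2K /= tagnat.Rank1K.
move: (nat_of_ord (tagnat.sig2 s)) => i1.
by case: eqVneq => [->|_]; [rewrite /f mulrC|rewrite mulr0].
Qed.

Lemma mulmx_chain_mx (C : numClosedFieldType) n r (k : 'I_r -> nat)
    (E : 'I_r -> nat -> 'cV[C]_n) (x : 'cV_(\sum_j k j))
    (c : 'I_r -> nat -> C) :
  (forall s, x s 0 = c (tagnat.sig1 s) (tagnat.sig2 s)) ->
  chain_mx k E *m x = \sum_j \sum_(i < k j) c j i *: E j i.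
Proof.
move=> xc; rewrite -(big_tagnat k (fun j i => c j i *: E j i)).
apply/colP => a; rewrite mxE summxE; apply: eq_bigr => s _.
by rewrite !mxE xc mulrC.
Qed.

(** The kernel of the chain matrix is stable under the Jordan matrix, so if nonzero it contains an
    eigenvector [x] of the latter. Such an [x] is supported on the bottoms of the chains with its
    eigenvalue, and pairing by [G] shows that these bottoms are independent. *)
Lemma chain_free (C : numClosedFieldType) n (A G : 'M[C]_n) r
    (k : 'I_r -> nat) (l : 'I_r -> C) (E : 'I_r -> nat -> 'cV[C]_n) :
  jordan_chains A k l E -> (forall j, 0 < k j)%N ->
  (forall j j', l j = l j' ->
     (E j 0%N)^t* *m G *m E j' 0%N = (j == j')%:R%:M) ->
  exists P, P *m chain_mx k E = 1%:M.
Proof.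
move=> ch k0 orth; apply: injmx_left_inverse => x0 Qx0.
apply/eqP/negPn/negP => x0nz.
pose T := \mxdiag_(j < r) jordan_block (k j) (l j).
have stab (x : 'cV_(\sum_j k j)) : chain_mx k E *m x = 0 -> chain_mx k E *m (T *m x) = 0.
  by move=> e; rewrite mulmxA -(mul_chain_mx ch) -mulmxA e mulmx0.
have [mu [x [xnz Qx Tx]]] := kernel_eigenvector stab Qx0 x0nz.
(* Coordinates are continued by 0 beyond the end of each chain, so that the recurrence [cS] holds
   for every [i]. *)
pose c j i : C := if insub i is Some i' then x (tagnat.Rank j i') 0 else 0.
have xc s : x s 0 = c (tagnat.sig1 s) (tagnat.sig2 s).
  by rewrite /c valK tagnat.sig2K.
have c0 j i : (k j <= i)%N -> c j i = 0.
  by move=> le; rewrite /c insubN // -leqNgt.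
have cS j i : (mu - l j) * c j i = c j i.+1.
  case: (ltnP i (k j)) => [lt|le]; last by rewrite !c0 ?mulr0 ?leqW.
  have /colP/(_ (tagnat.Rank j (Ordinal lt))) := Tx.
  rewrite [in RHS]mxE xc tagnat.Rank2K /= tagnat.Rank1K mulrBl => <-.
  rewrite mxE.
  pose b (j : 'I_r) (i i' : nat) : C := l j *+ (i == i') + (i.+1 == i')%:R.
  have bE j1 (i1 i2 : 'I_(k j1)) : jordan_block (k j1) (l j1) i1 i2 = b j1 i1 i2.
    by rewrite mxE.
  pose f (i' : nat) : C := b j i i' * c j i'.
  have -> : \sum_j0 T (tagnat.Rank j (Ordinal lt)) j0 * x j0 0 =
            \sum_(i' < k j) f i'.
    rewrite -big_tagnat_block; apply: eq_bigr => s _.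
    rewrite (mxdiagE _ _ bE) tagnat.Rank2K /= tagnat.Rank1K xc eq_sym.
    move: (nat_of_ord (tagnat.sig2 s)) => i1.
    by case: eqVneq => [->|_]; rewrite ?mul0r.
  rewrite (eq_bigr (fun i' : 'I_(k j) => (i' == i :> nat)%:R * (l j * c j i')
      + (i' == i.+1 :> nat)%:R * c j i')); last first.
    move=> i1 _; rewrite /f /b mulrDl !(mulrnAl, mulr_natl, mul1r).
    by rewrite ![_ == val i1]eq_sym.
  rewrite big_split /= (sum_ord_eq _ i (fun i' => l j * c j i')) lt.
  rewrite (sum_ord_eq _ i.+1 (c j)) addrAC subrr add0r.
  by case: ltnP => // /c0.
(* Where [mu - l j] is invertible, the recurrence carries the zeros beyond the end down the whole
   chain. *)
have cmu j i : l j != mu -> c j i = 0.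
  move=> ne; have [d] : exists d, (k j <= i + d)%N by exists (k j); rewrite leq_addl.
  elim: d i => [|d IH] i le; first by rewrite c0 //; move: le; rewrite addn0.
  have /eqP := cS j i; rewrite (IH i.+1) ?addSnnS // mulf_eq0 subr_eq0 eq_sym (negPf ne).
  by move/eqP.
have cpos j i : c j i.+1 = 0.
  case: (eqVneq (l j) mu) => [e|/cmu //].
  by rewrite -cS e subrr mul0r.
have Qxc : \sum_j c j 0%N *: E j 0%N = 0.
  rewrite -[RHS]Qx (mulmx_chain_mx _ xc); apply: eq_bigr => j _.
  case: (k j) (k0 j) => // kj _.
  by rewrite big_ord_recl big1 ?addr0 // => i _; rewrite cpos scale0r.
have c0z j : c j 0%N = 0.
  case: (eqVneq (l j) mu) => [e|/cmu //].
  have := congr1 (mulmx ((E j 0%N)^t* *m G)) Qxc.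
  rewrite mulmx0 mulmx_sumr (bigD1 j) //= big1 => [|j' ne].
    rewrite addr0 -scalemxAr orth // eqxx => /matrixP/(_ 0 0).
    by rewrite !mxE eqxx mulr1.
  rewrite -scalemxAr; case: (eqVneq (l j') mu) => [e'|/cmu ->].
    rewrite orth; last by rewrite e e'.
    by rewrite eq_sym (negPf ne) mulr0n raddf0 scaler0.
  by rewrite scale0r.
case/eqP: xnz; apply/colP => s; rewrite mxE xc.
by case: (nat_of_ord _) => [|i]; rewrite ?c0z ?cpos.
Qed.

(** * Semidefinite forms *)

Lemma left_inverse_right (F : comUnitRingType) m n (P : 'M[F]_(n, m)) Q :
  m = n -> Q *m P = 1%:M -> P *m Q = 1%:M.
Proof. by move=> e; case: n / e P Q => P Q; apply: mulmx1C. Qed.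

Lemma chain_similar (C : numClosedFieldType) n (A G : 'M[C]_n) r
    (k : 'I_r -> nat) (l : 'I_r -> C) (E : 'I_r -> nat -> 'cV[C]_n) :
  jordan_chains A k l E -> (forall j, 0 < k j)%N ->
  (forall j j', l j = l j' ->
     (E j 0%N)^t* *m G *m E j' 0%N = (j == j')%:R%:M) ->
  (\sum_j k j)%N = n ->
  mx_similar A (\mxdiag_(j < r) jordan_block (k j) (l j)).
Proof.
move=> ch k0 orth sk; have [Q QP] := chain_free ch k0 orth.
exists (chain_mx k E), Q; split => //; first exact: left_inverse_right.
by rewrite -mulmxA (mul_chain_mx ch) mulmxA QP mul1mx.
Qed.

(** A left inverse [P] of the chain matrix sends chain vectors to unit vectors, so the matrix of
    prescribed values can be pulled back along [P]. *)
Lemma form_of_values (C : numClosedFieldType) n r (k : 'I_r -> nat)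
    (E : 'I_r -> nat -> 'cV[C]_n) P (h : 'I_r -> nat -> 'I_r -> nat -> C) :
  P *m chain_mx k E = 1%:M ->
  (forall j i j' i', h j i j' i' = (h j' i' j i)^*) ->
  exists2 Y : 'M[C]_n, Y^t* = Y &
    forall j i j' i', (i < k j)%N -> (i' < k j')%N ->
      (E j i)^t* *m Y *m E j' i' = (h j i j' i')%:M.
Proof.
move=> PQ herm.
pose Hm : 'M[C]_(\sum_j k j) := \matrix_(s, t)
  h (tagnat.sig1 s) (tagnat.sig2 s) (tagnat.sig1 t) (tagnat.sig2 t).
exists (P^t* *m Hm *m P).
  rewrite !adjmxM trmxCK mulmxA; congr (_ *m _ *m _).
  by apply/matrixP => s t; rewrite !mxE -herm.
have PE j i (lt : (i < k j)%N) :
    P *m E j i = delta_mx (tagnat.Rank j (Ordinal lt)) 0.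
  rewrite -[E j i](col_chain_mx E (Ordinal lt)) colE mulmxA PQ mul1mx.
  by [].
move=> j i j' i' lt lt'.
rewrite !mulmxA -adjmxM -mulmxA !PE; apply: mx11_eq.
rewrite -mulmxA -colE mxE (bigD1 (tagnat.Rank j (Ordinal lt))) //= [X in _ + X]big1.
  rewrite !mxE !eqxx conjC1 mul1r addr0 !tagnat.Rank2K /= !tagnat.Rank1K.
  by rewrite mulr1n.
by move=> s ne; rewrite !mxE (negPf ne) conjC0 mul0r.
Qed.

Lemma adjmx_mul_eq0 (C : numClosedFieldType) n (u : 'cV[C]_n) :
  (u^t* *m u) 0 0 = 0 -> u = 0.
Proof.
rewrite mxE => /eqP; rewrite psumr_eq0 => [/allP z|i _].
  apply/colP => i; have := z i (mem_index_enum _); rewrite !mxE.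
  by rewrite mulrC mul_conjC_eq0 => /eqP.
by rewrite !mxE mulrC mul_conjC_ge0.
Qed.

Lemma psdmx_ker (C : numClosedFieldType) n (G : 'M[C]_n) (v : 'cV_n) :
  psdmx G -> v^t* *m G *m v = 0 -> G *m v = 0.
Proof.
move=> [/hermsymmxP Gh Gp] vGv; set u := G *m v.
have uE : u^t* = v^t* *m G by rewrite adjmxM Gh.
pose a := (u^t* *m u) 0 0; pose b := (u^t* *m G *m u) 0 0.
have a0 : 0 <= a.
  by rewrite /a mxE sumr_ge0 // => i _; rewrite !mxE mulrC mul_conjC_ge0.
have b0 : 0 <= b by apply: Gp.
have ar : a^* = a by apply/CrealP; rewrite ger0_real.
have br : (b + 1)^* = b + 1 by apply/CrealP; rewrite ger0_real // addr_ge0.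
have := Gp ((b + 1) *: v - a *: u).
(* The value of the form at (b + 1) v - a u is - a ^ 2 (b + 2). *)
rewrite adjmxD adjmxN !adjmxZ ar br !(mulmxDl, mulmxDr, mulNmx, mulmxN).
rewrite -?scalemxAl -?scalemxAr -?scalemxAl vGv -uE -[u^t* *m G *m v]mulmxA -/u.
rewrite [u^t* *m u]mx11_scalar -/a [u^t* *m G *m u]mx11_scalar -/b.
rewrite !scaler0 !mxE eqxx !mulr1n.
have -> : 0 - a * ((b + 1) * a) + (- ((b + 1) * (a * a)) - - (a * (a * b))) =
          - (a ^+ 2 * (b + 2)) by ring.
rewrite oppr_ge0 => le0; have b2 : 0 < b + 2 by rewrite ltr_wpDl.
move: le0; rewrite pmulr_lle0 // => a2.
apply: adjmx_mul_eq0; apply/eqP; rewrite -/a -sqrf_eq0 eq_le a2.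
exact: exprn_ge0.
Qed.

(** By the spectral theorem, orthonormal eigenvectors divided by the square roots of their positive
    eigenvalues serve as columns of [P]. *)
Lemma posdef_orthonormal (C : numClosedFieldType) n (H : 'M[C]_n) :
  H^t* = H -> (forall x : 'cV_n, x != 0 -> 0 < (x^t* *m H *m x) 0 0) ->
  exists P : 'M_n, P^t* *m H *m P = 1%:M.
Proof.
move=> /hermsymmxP Hh pos.
have /orthomx_spectralP := hermitian_normalmx Hh.
set U := spectralmx H; set d := spectral_diag H => HE.
have Uu : U \is unitarymx by exact: spectral_unitarymx.
have UU : U *m U^t* = 1%:M by apply/unitarymxP.
rewrite (invmx_unitary Uu) in HE.
have dpos i : 0 < d 0 i.
  have nz : U^t* *m delta_mx i 0 != 0 :> 'cV_n.
    apply/eqP => e; have := congr1 (mulmx U) e.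
    rewrite mulmx0 mulmxA UU mul1mx => /colP/(_ i); rewrite !mxE !eqxx => /eqP.
    by rewrite oner_eq0.
  have := pos _ nz; rewrite [X in _ *m X *m _]HE adjmxM trmxCK.
  rewrite !mulmxA -[_ *m U *m U^t*]mulmxA UU mulmx1.
  rewrite -[_ *m U *m U^t*]mulmxA UU mulmx1 -mulmxA -colE mxE.
  rewrite (bigD1 i) //= [X in _ + X]big1 => [|j ne]; last first.
    by rewrite !mxE (negPf ne) conjC0 mul0r.
  by rewrite !mxE !eqxx conjC1 mul1r addr0.
pose D := diag_mx (\row_i (sqrtC (d 0 i))^-1).
have Dh : D^t* = D.
  rewrite tr_diag_mx map_diag_mx; congr diag_mx; apply/rowP => i; rewrite !mxE.
  by apply/CrealP; rewrite realV ger0_real // sqrtC_ge0 ltW.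
exists (U^t* *m D); rewrite adjmxM trmxCK Dh [X in _ *m X *m _]HE !mulmxA.
rewrite -[_ *m U *m U^t*]mulmxA UU mulmx1 -[_ *m U *m U^t*]mulmxA UU mulmx1.
rewrite !mulmx_diag -diag_const_mx; congr diag_mx; apply/rowP => i; rewrite !mxE.
have s0 : sqrtC (d 0 i) != 0 by rewrite sqrtC_eq0 gt_eqF.
by rewrite -[X in _ * X * _](sqrtCK (d 0 i)) expr2 mulrA mulVf // mul1r mulfV.
Qed.

(** By [psdmx_ker], [G] is positive definite on the kernel of [B]. The [z t] are a [G]-orthonormal
    basis of the part of it that is [G]-orthogonal to the selected [d j], each of which costs at
    most one dimension. In the induction [A - lam] takes the place of [B]. *)
Lemma orthonormal_completion (C : numClosedFieldType) n (B G : 'M[C]_n) r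
    (P : pred 'I_r) (d : 'I_r -> 'cV[C]_n) :
  psdmx G -> (forall x : 'cV_n, B *m x = 0 -> G *m x = 0 -> x = 0) ->
  exists s (z : 'I_s -> 'cV[C]_n),
    [/\ forall t, B *m z t = 0,
        forall t t', (z t)^t* *m G *m z t' = (t == t')%:R%:M,
        forall j t, P j -> (d j)^t* *m G *m z t = 0
      & (n <= \rank B + #|P| + s)%N].
Proof.
move=> Gpsd def; have [/hermsymmxP Gh Gp] := Gpsd.
pose D1 : 'M[C]_(#|P|, n) := \matrix_(c, a) ((d (enum_val c))^t* *m G) 0 a.
pose S := col_mx B D1; pose N := (row_base (kermx S^T))^T.
have SN : S *m N = 0.
  apply: trmx_inj; rewrite trmx_mul trmxK trmx0; apply/sub_kermxP.
  by rewrite eq_row_base.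
have BN : B *m N = 0 by move: SN; rewrite mul_col_mx -col_mx0 => /eq_col_mx[].
have DN : D1 *m N = 0 by move: SN; rewrite mul_col_mx -col_mx0 => /eq_col_mx[].
have Ninj (x : 'cV_(\rank (kermx S^T))) : N *m x = 0 -> x = 0.
  move=> e; apply: trmx_inj; rewrite trmx0; apply/eqP.
  rewrite -(mulmx_free_eq0 _ (row_base_free (kermx S^T))).
  by rewrite -trmx_eq0 trmx_mul trmxK e.
have [||Q QE] := @posdef_orthonormal _ _ (N^t* *m G *m N).
- by rewrite !adjmxM trmxCK Gh mulmxA.
- move=> x; apply: contra_neqT => xn; apply: Ninj; apply: def.
    by rewrite mulmxA BN mul0mx.
  apply: psdmx_ker => //; apply: mx11_eq; rewrite [RHS]mxE.
  have := Gp (N *m x); rewrite adjmxM !mulmxA in xn *.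
  by rewrite le0r (negPf xn) orbF => /eqP.
have dG c : (d (enum_val c))^t* *m G = row c D1.
  by apply/rowP => a; rewrite !mxE.
exists (\rank (kermx S^T)), (fun t => N *m col t Q); split.
- by move=> t; rewrite mulmxA BN mul0mx.
- move=> t t'; rewrite !colE !adjmxM !mulmxA.
  have -> : (delta_mx t 0 : 'cV[C]_(\rank (kermx S^T)))^t* *m Q^t* *m N^t* *m G
      *m N *m Q = (delta_mx t 0)^t* *m (Q^t* *m (N^t* *m G *m N) *m Q).
    by rewrite !mulmxA.
  rewrite QE mulmx1; apply: mx11_eq; rewrite -colE !mxE eqxx andbT.
  by rewrite conjC_nat eq_sym.
- move=> j t Pj; have -> : d j = d (enum_val (enum_rank_in Pj j)).
    by rewrite enum_rankK_in.
  by rewrite dG -row_mul mulmxA DN mul0mx row0.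
rewrite mxrank_ker mxrank_tr -leq_subLR leq_sub2l // -addsmxE.
apply: leq_trans (mxrank_adds_leqif _ _) _.
by rewrite leq_add2l rank_leq_row.
Qed.

(** * Condensing chains *)

(** As [l j] is imaginary, [A^t*] contributes the factor [- l j] and [A] the factor [l j']; each
    also shifts one index of [h] down. For equal eigenvalues only the shifts remain. *)
Lemma lyapunov_chains (C : numClosedFieldType) n (A G Y : 'M[C]_n) r
    (k : 'I_r -> nat) (l : 'I_r -> C) (E : 'I_r -> nat -> 'cV[C]_n)
    (h : 'I_r -> nat -> 'I_r -> nat -> C) :
  jordan_chains A k l E -> (forall j, (l j)^* = - l j) ->
  (forall j i j' i', (i < k j)%N -> (i' < k j')%N ->
     (E j i)^t* *m Y *m E j' i' = (h j i j' i')%:M) ->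
  forall j i j' i', (i < k j)%N -> (i' < k j')%N ->
    (E j i)^t* *m (G + A^t* *m Y + Y *m A) *m E j' i' =
    (E j i)^t* *m G *m E j' i' +
    ((l j' - l j) * h j i j' i' + prevv (fun i => h j i j' i') i +
     prevv (h j i j') i')%:M.
Proof.
move=> ch lim hE j i j' i' lt lt'.
rewrite !mulmxDr !mulmxDl -!addrA; congr (_ + _).
have -> : (E j i)^t* *m (A^t* *m Y) *m E j' i' =
    (- (l j * h j i j' i') + prevv (fun i => h j i j' i') i)%:M.
  rewrite mulmxA -adjmxM ch // adjmxD adjmxZ lim !mulmxDl -!scalemxAl hE //.
  rewrite raddfD /= -mulNr; congr (_ + _).
    by rewrite scale_scalar_mx.
  case: i lt => [|i] lt /=; first by rewrite adjmx0 !mul0mx raddf0.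
  by rewrite hE // ltnW.
have -> : (E j i)^t* *m (Y *m A) *m E j' i' =
    (l j' * h j i j' i' + prevv (h j i j') i')%:M.
  rewrite -!mulmxA ch // !mulmxDr -!scalemxAr mulmxA hE // raddfD /=.
  congr (_ + _); first by rewrite scale_scalar_mx.
  case: i' lt' => [|i'] lt' /=; first by rewrite !mulmx0 raddf0.
  by rewrite mulmxA hE // ltnW.
by rewrite -raddfD /=; congr (_%:M); ring.
Qed.

(* [inl j] stands for the vector that lengthens chain [j], [inr t] for a new
   chain of length 1; the unknown [phi u] lists the values, on the old chains,
   of the Hermitian form paired with the new vector [u]. *)
Lemma extension_values (C : numClosedFieldType) r s (k : 'I_r -> nat)
    (l : 'I_r -> C) lam (rho : 'I_r + 'I_s -> 'I_r -> nat -> C)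
    (gg : 'I_r + 'I_s -> 'I_r + 'I_s -> C) :
  (forall u v, gg u v = (gg v u)^*) -> (forall j, 0 < k j)%N ->
  (forall u j, l j = lam -> rho u j 0%N = 0) ->
  exists phi : 'I_r + 'I_s -> 'I_r -> nat -> C,
  [/\ forall u j i, (i < k j)%N ->
        rho u j i + (l j - lam) * phi u j i + prevv (phi u j) i = 0,
      forall j j', l j = lam -> l j' = lam ->
        gg (inl j) (inl j') + (phi (inl j') j (k j).-1)^* +
        phi (inl j) j' (k j').-1 = 0
    & forall t j, l j = lam ->
        gg (inr t) (inl j) + phi (inr t) j (k j).-1 = 0].
Proof.
move=> ggh k0 rho0.
(* At the top of a [lam]-chain the value is free. Between two lengthening vectors, one value and one
   conjugate value together cancel [gg], so each takes half; against a new chain only one such term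
   occurs. *)
pose top u j := (if u is inl _ then - (gg u (inl j) / 2) else - gg u (inl j)).
pose rec u j := fix rec i := if i is i'.+1
  then - (rho u j i + rec i') / (l j - lam) else - rho u j 0%N / (l j - lam).
(* For [l j = lam] the equation at [i.+1] gives the value at [i], and the equation at 0 is [rho0].
   Otherwise [rec] solves the equations upwards. *)
pose phi u j i := if l j == lam
  then if (i.+1 < k j)%N then - rho u j i.+1 else top u j else rec u j i.
have phitop u j : l j = lam -> phi u j (k j).-1 = top u j.
  by move=> e; rewrite /phi e eqxx prednK // ltnn.
exists phi; split.
- move=> u j i lt; rewrite /phi; case: eqVneq => [e|ne].
    rewrite e subrr mul0r addr0; case: i lt => [|i] lt /=.
      by rewrite rho0 // addr0.
    by rewrite lt subrr.
  have nz : l j - lam != 0 by rewrite subr_eq0.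
  by case: i lt => [|i] lt /=; rewrite mulrC divfK //; ring.
- move=> j j' e e'; rewrite !phitop // /top [gg (inl j') _]ggh.
  rewrite rmorphN rmorphM /= conjCK fmorphV /= conjC_nat.
  have two : (2 : C) != 0 by rewrite pnatr_eq0.
  by field.
- by move=> t j e; rewrite phitop // /top subrr.
Qed.

(** The chains form a basis: [chain_free] and the last condition make them independent, and their
    lengths add up to [n]. *)
Definition condensing_chains (C : numClosedFieldType) n (A G : 'M[C]_n) r
    (k : 'I_r -> nat) (l : 'I_r -> C) (E : 'I_r -> nat -> 'cV[C]_n)
    (Y : 'M[C]_n) :=
  [/\ Y^t* = Y /\ (forall j, (l j)^* = - l j),
      (forall j, 0 < k j)%N,
      (\sum_j k j)%N = n,
      jordan_chains A k l E
    & forall j i j' i', (i < k j)%N -> (i' < k j')%N ->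
        (E j i)^t* *m (G + A^t* *m Y + Y *m A) *m E j' i' =
        [&& j == j', i == 0%N & i' == 0%N]%:R%:M].

(** [B] embeds the image of [A - lam], on which [A] acts as [lam%:M + D *m B], so it maps the old
    chains to chains of [A]. What remains is to choose the new vectors and the values of the new
    form on them. *)
Lemma condensing_chains_extend (C : numClosedFieldType) m n
    (A G : 'M[C]_n) (B : 'M_(n, m)) (D : 'M_(m, n)) lam r
    (k : 'I_r -> nat) (l : 'I_r -> C) (E : 'I_r -> nat -> 'cV[C]_m) Y0 :
  psdmx G -> lam^* = - lam ->
  (forall x : 'cV_n, B *m (D *m x) = 0 -> G *m x = 0 -> x = 0) ->
  A = lam%:M + B *m D -> \rank (B *m D) = m ->
  (exists D', D *m D' = 1%:M) ->
  condensing_chains (lam%:M + D *m B) (B^t* *m G *m B) k l E Y0 ->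
  exists r' (k' : 'I_r' -> nat) l' E' Y, condensing_chains A G k' l' E' Y.
Proof.
move=> Gpsd lamI def AE rkBD [D' DD'] [[Y0h lI] k0 sk ch form].
have [/hermsymmxP Gh _] := Gpsd.
pose hW j i j' i' : C := ((E j i)^t* *m Y0 *m E j' i') 0 0.
have hWE j i j' i' : (E j i)^t* *m Y0 *m E j' i' = (hW j i j' i')%:M.
  exact: mx11_scalar.
have adj11 (M : 'M[C]_1) : (M 0 0)^* = M^t* 0 0 by rewrite !mxE.
have hWh j i j' i' : hW j i j' i' = (hW j' i' j i)^*.
  by rewrite /hW adj11 !adjmxM trmxCK Y0h mulmxA.
pose g (x y : 'cV[C]_n) : C := (x^t* *m G *m y) 0 0.
have gE (x y : 'cV[C]_n) : x^t* *m G *m y = (g x y)%:M by apply: mx11_scalar.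
have gh x y : g x y = (g y x)^* by rewrite /g adj11 !adjmxM trmxCK Gh mulmxA.
pose old j i : 'cV[C]_n := B *m E j i.
have oldE j i j' i' : (i < k j)%N -> (i' < k j')%N ->
    g (old j i) (old j' i') + ((l j' - l j) * hW j i j' i' +
      prevv (fun i => hW j i j' i') i + prevv (hW j i j') i') =
    [&& j == j', i == 0%N & i' == 0%N]%:R.
  move=> lt lt'; have := form j i j' i' lt lt'.
  rewrite (lyapunov_chains _ ch lI (fun j i j' i' _ _ => hWE j i j' i') lt lt') => /matrixP/(_ 0 0).
  rewrite /g /old adjmxM !mulmxA [RHS]mxE eqxx mulr1n => <-.
  by rewrite [RHS]mxE; congr (_ + _); rewrite mxE eqxx mulr1n.
have AB : A *m B = B *m (lam%:M + D *m B).
  by rewrite AE mulmxDl mulmxDr mul_scalar_mx mul_mx_scalar mulmxA.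
have Aold j i : (i < k j)%N -> A *m old j i = l j *: old j i + prevv (old j) i.
  move=> lt; rewrite /old mulmxA AB -mulmxA ch // mulmxDr -scalemxAr.
  by congr (_ + _); case: i {lt} => [|i] /=; rewrite ?mulmx0.
have Dold j i : (i < k j)%N -> D *m old j i =
    (l j - lam) *: E j i + prevv (E j) i.
  move=> lt; have := ch j i lt; rewrite mulmxDl mul_scalar_mx -mulmxA => e.
  by rewrite /old -[LHS](addKr (lam *: E j i)) e scalerBl addrA [- _ + _]addrC.
pose J : pred 'I_r := fun j => l j == lam.
pose d j := old j 0%N.
have Ad j : J j -> B *m (D *m d j) = 0.
  by move=> /eqP e; rewrite Dold // e subrr scale0r addr0 mulmx0.
(* For equal eigenvalues the condition at the bottoms contains no value of [Y0], so these
   eigenvectors are orthonormal for [G] itself. *)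
have dd j j' : l j = l j' -> g (d j) (d j') = (j == j')%:R.
  move=> e; have := oldE j 0%N j' 0%N (k0 _) (k0 _).
  by rewrite e subrr mul0r /= !addr0 !andbT.
have def' (x : 'cV_n) : B *m D *m x = 0 -> G *m x = 0 -> x = 0.
  by rewrite -mulmxA; apply: def.
have [s [z [Bz zz dz cnt]]] := orthonormal_completion J d Gpsd def'.
pose f0 j := D' *m E j (k j).-1.
pose c j j' := - (g (f0 j) (d j') + hW j (k j).-1 j' 0%N)^*.
pose f j := f0 j + \sum_(j' | J j') c j j' *: d j'.
have Df j : B *m (D *m f j) = old j (k j).-1.
  rewrite mulmxDr mulmxA DD' mul1mx mulmxDr mulmx_sumr mulmx_sumr big1 ?addr0 //.
  by move=> j' Jj'; rewrite -!scalemxAr Ad // scaler0.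
pose F (u : 'I_r + 'I_s) := match u with inl j => f j | inr t => z t end.
pose gg u v := g (F u) (F v).
pose rho u j i := g (F u) (old j i) +
  (if u is inl j' then hW j' (k j').-1 j i else 0).
have ggh u v : gg u v = (gg v u)^* by apply: gh.
have gdz j t : l j = lam -> g (d j) (z t) = 0.
  by move=> /eqP Jj; rewrite /g dz // mxE.
have gzz t t' : g (z t) (z t') = (t == t')%:R.
  by rewrite /g zz mxE eqxx mulr1n.
have rho0 u j : l j = lam -> rho u j 0%N = 0.
  move=> e; have Jj : J j by apply/eqP.
  case: u => [j'|t]; rewrite /rho /=.
    have -> : g (f j') (old j 0%N) = g (f0 j') (d j) + (c j' j)^*.
      rewrite /g adjmxD !mulmxDl [LHS]mxE; congr (_ + _).
      rewrite raddf_sum /= map_mx_sum !mulmx_suml (bigD1 j) //= big1 ?addr0.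
        by rewrite adjmxZ -!scalemxAl gE dd // eqxx !mxE eqxx mulr1.
      move=> j1 /andP[/eqP e1 ne]; rewrite adjmxZ -!scalemxAl gE dd ?e ?e1 //.
      by rewrite (negPf ne) raddf0 scaler0.
    by rewrite /c rmorphN /= conjCK; ring.
  by rewrite addr0 gh gdz // conjC0.
have [phi [phi1 phi2 phi3]] := extension_values ggh k0 rho0.
pose ks (u : 'I_r + 'I_s) : nat :=
  match u with inl j => (k j + J j)%N | inr _ => 1%N end.
pose ls (u : 'I_r + 'I_s) := match u with inl j => l j | inr _ => lam end.
(* [ov u i] is the old chain to which position [i] belongs, or [None] at an added vector. *)
pose ov (u : 'I_r + 'I_s) i : option 'I_r :=
  if u is inl j then if (i < k j)%N then Some j else None else None.
pose Es u i := if ov u i is Some j then old j i else F u.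
(* The new form keeps its old values, takes [phi] or its conjugate on mixed pairs, and 0 on pairs of
   added vectors. *)
pose hs u i v i' : C := match ov u i, ov v i' with
  | Some j, Some j' => hW j i j' i'
  | Some j, None => (phi v j i)^*
  | None, Some j' => phi u j' i'
  | None, None => 0 end.
pose k1 (x : 'I_(r + s)) := ks (split x).
pose l1 (x : 'I_(r + s)) := ls (split x).
pose E1 (x : 'I_(r + s)) := Es (split x).
have lsI u : (ls u)^* = - ls u by case: u => [j|t] /=.
have ks0 u : (0 < ks u)%N by case: u => [j|t] //=; rewrite ltn_addr.
have hsh u i v i' : hs u i v i' = (hs v i' u i)^*.
  by rewrite /hs; case: (ov u i) => [j|]; case: (ov v i') => [j'|];
    rewrite ?conjCK ?conjC0.
have newP u i : (i < ks u)%N -> ov u i = None ->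
    match u with inl j => J j /\ i = (k j).-1.+1 | inr _ => i = 0%N end.
  case: u => [j|t] /=; last by case: i.
  case: (ltnP i (k j)) => // le lt _; have Jj : J j.
    by move: lt; rewrite /J; case: (l j == lam) => //=; rewrite addn0 ltnNge le.
  move: lt; rewrite Jj /= addn1 ltnS (prednK (k0 j)) => le'.
  by split=> //; apply/eqP; rewrite eqn_leq le'.
have oldP u i j : ov u i = Some j -> u = inl j /\ (i < k j)%N.
  by case: u => [j'|t] //=; case: ltnP => // lt [<-].
have ovE j i : (i < k j)%N -> ov (inl j) i = Some j by move=> /= ->.
have ch1 : jordan_chains A k1 l1 E1.
  move=> x i; rewrite /k1 /l1 /E1; move: (split x) => u lt.
  case o : (ov u i) => [j|].
    have [uE lt'] := oldP _ _ _ o; subst u; rewrite {1 2}/Es /= lt' Aold //.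
    congr (_ + _); case: i {lt o} lt' => [|i] //= lt'.
    by rewrite /Es /= (ltnW lt').
  have := newP _ _ lt o; rewrite {1 2}/Es o AE mulmxDl mul_scalar_mx -mulmxA.
  case: u {lt o} => [j [/eqP e ->]|t ->] /=; last by rewrite mulmxA Bz.
  by rewrite Df e /Es /= (prednK (k0 j)) leqnn.
(* Old chains grow at the top and keep their bottoms, and the [z t] are [G]-orthogonal to the
   [lam]-bottoms, so [chain_free] applies with [G]. *)
have ends x y : l1 x = l1 y -> (E1 x 0%N)^t* *m G *m E1 y 0%N = (x == y)%:R%:M.
  rewrite -(inj_eq (can_inj splitK)) /l1 /E1 gE; move: (split x) (split y) => u v.
  case: u => [j|t]; case: v => [j'|t'] /=; rewrite /Es /= ?k0 => e.
  - by rewrite dd.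
  - by rewrite gdz.
  - by rewrite gh gdz ?conjC0.
  - by rewrite gzz.
have [Q QP] := chain_free ch1 (fun x => ks0 _) ends.
have [Y Yh YE] := form_of_values QP (fun x i y i' => hsh (split x) i (split y) i').
(* Independence bounds the total length by [n] from above; [cnt] bounds it from below, the old
   chains giving the rank, the lengthenings [#|J|], and the new chains [s]. *)
have sk1 : (\sum_x k1 x)%N = n.
  apply/eqP; rewrite eqn_leq; apply/andP; split.
    rewrite -(mxrank1 C (\sum_x k1 x)) -QP.
    exact: leq_trans (mxrankM_maxr _ _) (rank_leq_row _).
  apply: leq_trans cnt _; rewrite rkBD -{1}sk big_split_ord /= leq_add //.
    rewrite -sum1_card (big_mkcond J) -big_split /= leq_sum // => j _.
    by rewrite /k1 (unsplitK (inl _ j)) /= leq_add2l; case: (J j).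
  rewrite -[leqLHS]muln1 -[in leqLHS](card_ord s) -sum_nat_const leq_sum // => t _.
  by rewrite /k1 (unsplitK (inr _ t)).
exists (r + s)%N, k1, l1, E1, Y; split=> //.
  by split=> // x; apply: lsI.
  by move=> x; apply: ks0.
move=> x i y i' lt lt'.
rewrite (lyapunov_chains _ ch1 (fun x => lsI _) YE lt lt') gE -raddfD /=.
congr (_%:M); rewrite -(inj_eq (can_inj splitK)).
move: lt lt'; rewrite /k1 /l1 /E1; move: (split x) (split y) => {x y}.
pose lhs u i v i' := g (Es u i) (Es v i') + ((ls v - ls u) * hs u i v i' +
  prevv (fun i => hs u i v i') i + prevv (hs u i v) i').
(* By this symmetry it suffices to treat pairs of old vectors and pairs whose first vector is
   new. *)
have lhsh u i1 v i2 : lhs u i1 v i2 = (lhs v i2 u i1)^*.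
  rewrite /lhs !rmorphD /= rmorphM rmorphB /= !lsI -gh -hsh opprK.
  rewrite [- _ + _]addrC -!addrA; congr (_ + (_ + _)); rewrite addrC.
  congr (_ + _).
    by case: i2 => [|i2] /=; rewrite ?conjC0 // -hsh.
  by case: i1 => [|i1] /=; rewrite ?conjC0 // -hsh.
(* [phi1] settles an old second vector. For two new ones the shifts hit old tops, which [phi2] and
   [phi3] handle, or vanish, which leaves the orthonormal [z]. *)
have lhs_new u i1 v i2 : (i1 < ks u)%N -> ov u i1 = None -> (i2 < ks v)%N ->
    lhs u i1 v i2 = [&& u == v, i1 == 0%N & i2 == 0%N]%:R.
  move=> lt o lt'; have u_new := newP _ _ lt o.
  case o' : (ov v i2) => [j'|].
    have [vE lt2] := oldP _ _ _ o'; subst v.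
    have -> : lhs u i1 (inl j') i2 = rho u j' i2 + (l j' - lam) * phi u j' i2 +
        prevv (phi u j') i2.
      have -> : prevv (phi u j') i2 = prevv (hs u i1 (inl j')) i2.
        by case: i2 lt2 {lt' o'} => [|i2] //= /ltnW lt2; rewrite /hs o ovE.
      rewrite /lhs /Es /hs o o' /rho.
      case: u o u_new {lt} => [j|t] o /= => [[/eqP -> ->]|->] /=; last by ring.
      by rewrite (prednK (k0 j)) leqnn; ring.
    rewrite phi1 //; case: u u_new {lt o} => [j [_ ->]|t _] //=.
    by rewrite andbF.
  have v_new := newP _ _ lt' o'; rewrite /lhs /Es /hs o o'.
  case: u o u_new {lt} => [j|t] o /= => [[/eqP e ->]|->] /=;
    case: v o' v_new {lt'} => [j'|t'] o' /= => [[/eqP e' ->]|->] /=.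
  - rewrite !(prednK (k0 _)) !leqnn e e' subrr mul0r add0r andbF.
    by rewrite addrA; apply: phi2.
  - rewrite (prednK (k0 _)) leqnn e subrr mul0r add0r addr0 -[RHS]conjC0.
    by rewrite -(phi3 t' j) // rmorphD /= -ggh.
  - rewrite (prednK (k0 _)) leqnn e' subrr mul0r !add0r.
    by rewrite [LHS]phi3.
  - by rewrite subrr mul0r !addr0 gzz !andbT.
move=> u v lt lt'; rewrite -/(lhs u i v i').
case o : (ov u i) => [j|]; last by rewrite lhs_new.
case o' : (ov v i') => [j'|]; last first.
  rewrite lhsh lhs_new // conjC_nat [v == u]eq_sym.
  by rewrite [(i' == _) && _]andbC.
have [uE lt1] := oldP _ _ _ o; have [vE lt2] := oldP _ _ _ o'; subst u v.
rewrite (_ : (inl j == inl j' :> 'I_r + 'I_s) = (j == j')) // -oldE //.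
rewrite /lhs /Es /hs o o' /=; congr (_ + (_ + _ + _)).
  by case: i lt1 {lt o} => [|i] //= /ltnW lt1; rewrite lt1.
by case: i' lt2 {lt' o'} => [|i'] //= /ltnW lt2; rewrite lt2.
Qed.

Lemma rank_factorization (F : fieldType) m n (A : 'M[F]_(m, n)) :
  exists (B : 'M_(m, \rank A)) (D : 'M_(\rank A, n)),
    [/\ B *m D = A, exists B', B' *m B = 1%:M & exists D', D *m D' = 1%:M].
Proof.
exists (col_base A), (row_base A); split; first exact: mulmx_base.
  exact/row_fullP/col_base_full.
exact/row_freeP/row_base_free.
Qed.

(** The induction passes to the image of [A - lam], of dimension below [n]. Eigenvalues of the
    restriction are eigenvalues of [A], and the condition on eigenvectors is inherited through
    [psdmx_ker]. *)
Lemma condensing_chains_exist (C : numClosedFieldType) n (A G : 'M[C]_n) :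
  psdmx G -> (forall a, eigenvalue A a -> a^* = - a) ->
  (forall a (x : 'cV_n), A *m x = a *: x -> G *m x = 0 -> x = 0) ->
  exists r (k : 'I_r -> nat) l E Y, condensing_chains A G k l E Y.
Proof.
have [m] := ubnP n; elim: m n A G => // m IH n A G ltn Gpsd Aeig obs.
have [n0|n0] := posnP n.
  exists 0%N, (fun=> 0%N), (fun=> 0), (fun _ _ => 0), 0; subst n.
  split; last by case.
  - by split=> [|[]] //; rewrite adjmx0.
  - by case.
  - by rewrite big_ord0.
  - by case.
have [lam lamA] := eigenvalue_closed A n0.
pose N := A - lam%:M.
have [B [D [BD [B' B'B] [D' DD']]]] := rank_factorization N.
have AE : A = lam%:M + B *m D by rewrite BD addrC subrK.
have AB : A *m B = B *m (lam%:M + D *m B).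
  by rewrite AE mulmxDl mulmxDr mul_scalar_mx mul_mx_scalar mulmxA.
have B0 (x : 'cV_(\rank N)) : B *m x = 0 -> x = 0.
  by move=> e; rewrite -[x]mul1mx -B'B -mulmxA e mulmx0.
have rkN : (\rank N < m)%N.
  rewrite -ltnS; apply: leq_trans ltn; rewrite ltnS ltn_neqAle rank_leq_row.
  rewrite andbT; have := lamA; rewrite /eigenvalue /eigenspace -mxrank_eq0.
  by rewrite mxrank_ker subn_eq0 leqNgt ltn_neqAle rank_leq_row andbT negbK.
have [/hermsymmxP Gh Gp] := Gpsd.
have [||| r [k [l [E [Y c]]]]] := IH _ (lam%:M + D *m B) (B^t* *m G *m B) rkN.
- split=> [|x].
    by apply/hermsymmxP; rewrite !adjmxM trmxCK Gh mulmxA.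
  by have := Gp (B *m x); rewrite adjmxM !mulmxA.
- move=> a /eigenvalue_colP[x e xnz]; apply: Aeig; apply/eigenvalue_colP.
  exists (B *m x); first by rewrite mulmxA AB -mulmxA e -scalemxAr.
  by apply: contra_neq xnz; apply: B0.
- move=> a x e Gx; apply: B0; apply: (obs a).
    by rewrite mulmxA AB -mulmxA e -scalemxAr.
  apply: psdmx_ker => //; rewrite adjmxM -!mulmxA.
  by move: Gx; rewrite -!mulmxA => ->; rewrite mulmx0.
apply: (condensing_chains_extend _ _ _ AE _ _ c) => //.
- exact: Aeig.
- move=> x BDx; apply: (obs lam); rewrite AE mulmxDl mul_scalar_mx -mulmxA.
  by rewrite BDx addr0.
- by rewrite BD.
- by exists D'.
Qed.

(** * The condensed form *)

Lemma adjmxE (C : numClosedFieldType) m n (A : 'M[C]_(m, n)) i j :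
  A^t* i j = (A j i)^*.
Proof. by rewrite !mxE. Qed.

Lemma mxdiag_RankrE (V : nmodType) r (k : 'I_r -> nat)
    (B : forall j, 'M[V]_(k j)) (b : 'I_r -> nat -> nat -> V) s j
    (i : 'I_(k j)) :
  (forall j i i', B j i i' = b j i i') ->
  (\mxdiag_(j < r) B j) s (tagnat.Rank j i) =
  if tagnat.sig1 s == j then b j (tagnat.sig2 s) i else 0.
Proof.
move=> Bb; rewrite (mxdiagE _ _ Bb) tagnat.Rank2K /= tagnat.Rank1K.
move: (nat_of_ord (tagnat.sig2 s)) => i1.
by case: (eqVneq (tagnat.sig1 s) j) => // ->.
Qed.

Lemma mxdiag_RanklE (V : nmodType) r (k : 'I_r -> nat)
    (B : forall j, 'M[V]_(k j)) (b : 'I_r -> nat -> nat -> V) t j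
    (i : 'I_(k j)) :
  (forall j i i', B j i i' = b j i i') ->
  (\mxdiag_(j < r) B j) (tagnat.Rank j i) t =
  if tagnat.sig1 t == j then b j i (tagnat.sig2 t) else 0.
Proof.
move=> Bb; rewrite (mxdiagE _ _ Bb) tagnat.Rank2K /= tagnat.Rank1K.
by rewrite eq_sym.
Qed.

Definition jordan_entry (C : numClosedFieldType) r (l : 'I_r -> C) j
    (i i' : nat) : C := l j *+ (i == i') + (i.+1 == i')%:R.

Lemma jordan_entryE (C : numClosedFieldType) r (k : 'I_r -> nat)
    (l : 'I_r -> C) j (i i' : 'I_(k j)) :
  jordan_block (k j) (l j) i i' = jordan_entry l j i i'.
Proof. by rewrite mxE. Qed.

Definition last_entry (C : numClosedFieldType) r (k : 'I_r -> nat) j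
    (i i' : nat) : C := ((i.+1 == k j) && (i'.+1 == k j))%:R.

Lemma last_entryE (C : numClosedFieldType) r (k : 'I_r -> nat) j
    (i i' : 'I_(k j)) :
  (last_col C (k j) *m (last_col C (k j))^t*) i i' = last_entry C k j i i'.
Proof.
by rewrite mxE big_ord1 !mxE conjC_nat -natrM mulnb.
Qed.

(** With [i] in [nat] one may run past the end of a block, where the vector is 0; the adjoint Jordan
    matrix then needs no end case. *)
Definition block_delta (C : numClosedFieldType) r (k : 'I_r -> nat)
    (j : 'I_r) (i : nat) : 'cV[C]_(\sum_j k j) :=
  \col_s ((tagnat.sig1 s == j) && (tagnat.sig2 s == i :> nat))%:R.

Lemma block_deltaE (C : numClosedFieldType) r (k : 'I_r -> nat) j
    (i : 'I_(k j)) : block_delta C k j i = delta_mx (tagnat.Rank j i) 0.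
Proof.
apply/colP => s; rewrite !mxE andbT; congr (_%:R); congr nat_of_bool.
rewrite -[in RHS](tagnat.sig2K s); apply: esym.
exact: (tagnat.eq_Rank (tagnat.sig2 s) i).
Qed.

Lemma block_delta0 (C : numClosedFieldType) r (k : 'I_r -> nat) j i :
  (k j <= i)%N -> block_delta C k j i = 0.
Proof.
move=> le; apply/colP => s; rewrite !mxE; case: eqP => //= e.
by rewrite ltn_eqF // (leq_trans (ltn_ord _)) // e.
Qed.


Lemma mul_jordan_delta (C : numClosedFieldType) r (k : 'I_r -> nat)
    (l : 'I_r -> C) j i : (i < k j)%N ->
  (\mxdiag_(j < r) jordan_block (k j) (l j)) *m block_delta C k j i =
  l j *: block_delta C k j i + prevv (block_delta C k j) i.
Proof.
move=> lt; rewrite [in LHS](block_deltaE _ (Ordinal lt)) -colE.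
apply/colP => s; rewrite [LHS]mxE.
rewrite (mxdiag_RankrE _ _ (@jordan_entryE _ _ k l)) /jordan_entry !mxE /=.
case: i {lt} => [|i] /=; rewrite !mxE; case: eqP => //= _;
  by rewrite ?mulr0 ?addr0 ?mulr_natr.
Qed.

Lemma mul_jordan_adj_delta (C : numClosedFieldType) r (k : 'I_r -> nat)
    (l : 'I_r -> C) j i : (i < k j)%N ->
  (\mxdiag_(j < r) jordan_block (k j) (l j))^t* *m block_delta C k j i =
  (l j)^* *: block_delta C k j i + block_delta C k j i.+1.
Proof.
move=> lt; rewrite [in LHS](block_deltaE _ (Ordinal lt)) -colE.
apply/colP => s; rewrite [LHS]mxE adjmxE.
rewrite (mxdiag_RanklE _ _ (@jordan_entryE _ _ k l)) /jordan_entry !mxE /=.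
case: eqP => /= _; last by rewrite mulr0 addr0 conjC0.
by rewrite rmorphD /= conjC_nat rmorphMn /= mulr_natr ![_ == tagnat.sig2 s :> nat]eq_sym.
Qed.

Lemma mul_last_delta (C : numClosedFieldType) r (k : 'I_r -> nat) j i :
  (i < k j)%N ->
  (\mxdiag_(j < r) (last_col C (k j) *m (last_col C (k j))^t*)) *m
    block_delta C k j i =
  (i.+1 == k j)%:R *: block_delta C k j i.
Proof.
move=> lt; rewrite [in LHS](block_deltaE _ (Ordinal lt)) -colE.
apply/colP => s; rewrite [LHS]mxE.
rewrite (mxdiag_RankrE _ _ (@last_entryE C _ k)) /last_entry !mxE /=.
case: eqP => //= _; rewrite ?mulr0 // -natrM mulnb; congr (_%:R).
congr nat_of_bool; rewrite andbC; case: eqP => //= <-.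
by rewrite eqSS.
Qed.

Lemma condensed_similar (C : numClosedFieldType) n r (k : 'I_r -> nat)
    (l : 'I_r -> C) (k_sum : (\sum_j k j)%N = n) :
  (forall j, 0 < k j)%N -> (forall j, (l j)^* = - l j) ->
  let T := castmx (k_sum, k_sum) (\mxdiag_(j < r) jordan_block (k j) (l j)) in
  let G := castmx (k_sum, k_sum)
    (\mxdiag_(j < r) (last_col C (k j) *m (last_col C (k j))^t* )) in
  mx_similar (block_mx T G 0 (- T^t* ))
    (\mxdiag_(j < r) jordan_block (k j).*2 (l j)).
Proof.
move=> k0 lI; case: n / k_sum; rewrite !castmx_id => T G.
set M := block_mx _ _ _ _.
pose e j i : 'cV[C]_(\sum_j k j + \sum_j k j) := col_mx (block_delta C k j i) 0.
pose f j i : 'cV[C]_(\sum_j k j + \sum_j k j) := col_mx 0 (block_delta C k j i).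
(* The chain runs up through the e_i and then, with alternating signs, down
   through the f_i; G links the two halves. *)
pose E j i := if (i < k j)%N then e j i
  else (-1) ^+ (i - k j) *: f j (k j - (i - k j).+1)%N.
have Me j i : (i < k j)%N -> M *m e j i = l j *: e j i + prevv (e j) i.
  move=> lt; rewrite mul_block_col !mulmx0 mul0mx !addr0 mul_jordan_delta //.
  rewrite scale_col_mx scaler0; case: i lt => [|i] _ /=.
    by rewrite !addr0.
  by rewrite add_col_mx addr0.
have Mf j i : (i < k j)%N -> M *m f j i =
    l j *: f j i + (i.+1 == k j)%:R *: e j i - f j i.+1.
  move=> lt; rewrite mul_block_col !mulmx0 !add0r mul_last_delta // mulNmx.
  rewrite mul_jordan_adj_delta // lI scaleNr opprD opprK.
  by rewrite !scale_col_mx opp_col_mx !add_col_mx !scaler0 oppr0 !addr0 add0r.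
have fk j : f j (k j) = 0 by rewrite /f block_delta0 // col_mx0.
(* With the identity as form, it suffices that the bottoms [e j 0] are orthonormal. *)
apply: (@chain_similar _ _ M 1%:M _ _ l E).
- move=> j i lt; rewrite /E; case: (ltnP i (k j)) => [lt'|le].
    rewrite Me //; congr (_ + _); case: i lt' {lt} => [|i] //= lt'.
    by rewrite (ltnW lt').
  pose p := (i - k j)%N; have iE : i = (k j + p)%N by rewrite subnKC.
  have pk : (p < k j)%N by rewrite ltn_subLR // addnn.
  rewrite -/p -scalemxAr Mf; last by rewrite ltn_subrL k0.
  rewrite -subSn // subSS.
  (* For [p = 0] the vector is the last [f]: the [f] after it is 0 by [fk], and [G] supplies the
     last [e] as its predecessor in the chain. *)
  case: p iE pk => [|p] iE pk.
    rewrite subn0 fk subr0 subn1 eqxx scale1r !expr0 !scale1r.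
    congr (_ + _); rewrite iE addn0; case: (k j) (k0 j) => //= kj _.
    by rewrite ltnSn.
  have -> : (k j - p.+1 == k j)%N = false.
    by rewrite ltn_eqF // ltn_subrL k0.
  rewrite scale0r addr0 scalerBr scalerA mulrC -scalerA; congr (_ + _).
  rewrite iE addnS /= ltnNge leq_addr /= addKn.
  by rewrite exprS mulN1r scaleNr opprK.
- by move=> j; rewrite double_gt0.
- move=> j j' _; rewrite mulmx1 /E !k0 /e adjmx_col mul_row_col mulmx0 addr0.
  rewrite (block_deltaE _ (Ordinal (k0 j))) (block_deltaE _ (Ordinal (k0 j'))).
  apply: mx11_eq; rewrite -colE !mxE conjC_nat eqxx !andbT mulr1n.
  have eR := tagnat.eq_Rank (Ordinal (k0 j)) (Ordinal (k0 j')).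
  congr (_%:R); congr nat_of_bool.
  by rewrite [LHS]eq_sym; apply: (etrans eR); apply: andbT.
- by rewrite -big_split /=; apply: eq_bigr => j _; rewrite addnn.
Qed.

Lemma eigenvalue_adj (C : numClosedFieldType) n (A : 'M[C]_n) a :
  eigenvalue (A^t*) a -> eigenvalue A a^*.
Proof.
case/eigenvalueP => v e nz; apply/eigenvalue_colP; exists (v^t*).
  by rewrite -adjmxZ -e adjmxM trmxCK.
by apply: contra_neq nz => v0; rewrite -[v]trmxCK v0 adjmx0.
Qed.

Lemma form_entry (C : numClosedFieldType) m n (Q : 'M[C]_(m, n)) S s t :
  (Q^t* *m S *m Q) s t = ((col s Q)^t* *m S *m col t Q) 0 0.
Proof.
rewrite [LHS]mxE [RHS]mxE; apply: eq_bigr => a _; congr (_ * _).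
  by rewrite [LHS]mxE [RHS]mxE; apply: eq_bigr => b _; rewrite !mxE.
by rewrite [RHS]mxE.
Qed.

(** The reversed chains of [T^t*] are the columns of [Q]. [Z] is the shear by the Hermitian [Y]
    times [block_mx Z11 0 0 Q], with [Z11] the inverse adjoint of [Q]; both factors are
    symplectic. *)
Lemma condensed_form (C : numClosedFieldType) n (T G : 'M[C]_n) :
  psdmx G -> (forall a, eigenvalue T a -> a^* = - a) ->
  (forall a (x : 'cV_n), T^t* *m x = a *: x -> G *m x = 0 -> x = 0) ->
  exists r (k : 'I_r -> nat) (l : 'I_r -> C) (k_sum : (\sum_(j < r) k j)%N = n),
  [/\ forall j, (0 < k j)%N, forall j, (l j)^* = - l j
    & exists Z11 Z12 : 'M[C]_n,
      let Z := block_mx Z11 Z12 0 ((invmx Z11)^t* ) in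
      let T' := castmx (k_sum, k_sum)
        (\mxdiag_(j < r) jordan_block (k j) (l j)) in
      let G' := castmx (k_sum, k_sum)
        (\mxdiag_(j < r) (last_col C (k j) *m (last_col C (k j))^t* )) in
      [/\ Z11 \in unitmx, symplectic Z
        & invmx Z *m block_mx T G 0 (- T^t* ) *m Z =
          block_mx T' G' 0 (- T'^t* )]].
Proof.
move=> Gpsd Teig obs.
have Aeig a : eigenvalue (T^t*) a -> a^* = - a.
  by move/eigenvalue_adj/Teig; rewrite conjCK => e; rewrite [in RHS]e opprK.
have [r [k [l [E [Y [[Yh lI] k0 sk ch form]]]]]] :=
  condensing_chains_exist Gpsd Aeig obs.
exists r, k, (fun j => (l j)^*), sk; split=> // [j|].
  by rewrite lI rmorphN /= lI.
subst n; set S := G + _ + _ in form.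
have [|P PM] := @chain_free _ _ _ S _ _ _ _ ch k0.
  by move=> j j' _; rewrite form // !andbT.
(* Chains are numbered from the eigenvector, whereas the adjoint of an upper Jordan block has its
   eigenvector last; hence the reversal inside each block. It also moves the nonzero value of the
   form to the last position. *)
pose sg (s : 'I_(\sum_j k j)) :=
  tagnat.Rank (tagnat.sig1 s) (rev_ord (tagnat.sig2 s)).
have sgR j (i : 'I_(k j)) : sg (tagnat.Rank j i) = tagnat.Rank j (rev_ord i).
  apply/val_inj/eqP; apply: etrans (tagnat.eq_Rank _ _) _.
  by rewrite /= tagnat.Rank2K /= tagnat.Rank1K !eqxx.
have sgK : involutive sg.
  by move=> s; rewrite -[s]tagnat.sig2K !sgR rev_ordK.
have sg_inj := inv_inj sgK.
pose M := chain_mx k E; pose Q := colsub sg M.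
pose J := \mxdiag_(j < r) jordan_block (k j) (l j).
pose T' := \mxdiag_(j < r) jordan_block (k j) (l j)^*.
pose G' := \mxdiag_(j < r) (last_col C (k j) *m (last_col C (k j))^t* ).
have PQ : rowsub sg P *m Q = 1%:M.
  rewrite -mxsub_mul PM; apply/matrixP => s t; rewrite !mxE.
  by rewrite (inj_eq sg_inj).
have T'E : T'^t* = mxsub sg sg J.
  apply/matrixP => s t; rewrite adjmxE [RHS]mxE.
  rewrite (mxdiagE _ _ (@jordan_entryE _ _ k (fun j => (l j)^*))).
  rewrite (mxdiag_RankrE _ _ (@jordan_entryE _ _ k l)).
  rewrite tagnat.Rank2K /= tagnat.Rank1K /jordan_entry.
  move: (tagnat.sig1 s) (tagnat.sig1 t) (tagnat.sig2 s) (tagnat.sig2 t).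
  move=> j j' i i'; rewrite eq_sym; case: eqVneq i' => [<-|_] i'.
    rewrite rmorphD /= conjC_nat rmorphMn /= conjCK.
    by congr (_ *+ nat_of_bool _ + (nat_of_bool _)%:R); apply/eqP/eqP;
      have := ltn_ord i; have := ltn_ord i'; lia.
  by rewrite conjC0.
have AQ : T^t* *m Q = Q *m T'^t*.
  rewrite T'E /Q mulmx_colsub (mul_chain_mx ch) -/M -/J.
  apply/matrixP => a t; rewrite !mxE (reindex_inj sg_inj) /=.
  by apply: eq_bigr => s _; rewrite !mxE.
have colQ s : col s Q = E (tagnat.sig1 s) (k (tagnat.sig1 s) - (tagnat.sig2 s).+1)%N.
  apply/colP => a; rewrite !mxE /sg.
  by rewrite tagnat.Rank2K /= tagnat.Rank1K.
have QSQ : Q^t* *m S *m Q = G'.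
  apply/matrixP => s t; rewrite (mxdiagE _ _ (@last_entryE C _ k)) /last_entry.
  rewrite form_entry !colQ form ?ltn_subrL ?k0 // mxE eqxx mulr1n.
  move: (tagnat.sig1 s) (tagnat.sig1 t) (tagnat.sig2 s) (tagnat.sig2 t).
  move=> j j' i i'; case: eqVneq i' => [<-|_] i' //=.
  congr (nat_of_bool (_ && _))%:R; apply/eqP/eqP;
    by have := ltn_ord i; have := ltn_ord i'; lia.
have QP := mulmx1C PQ; set P' := rowsub sg P in PQ QP.
have [QU PU] := mulmx1_unit QP.
have PE : invmx Q = P'.
  by rewrite -[invmx Q]mulmx1 -QP mulKmx.
pose Z11 := P'^t*; have Z11Q : (invmx Z11)^t* = Q.
  by rewrite adjmx_inv trmxCK -PE invmxK.
have Z11E : Q^t* *m Z11 = 1%:M by rewrite -adjmxM PQ adjmx1.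
have Z11E' : Z11 *m Q^t* = 1%:M by apply: mulmx1C.
have Z11E'' : Z11^t* *m Q = 1%:M by rewrite trmxCK.
have Z11U : Z11 \in unitmx by rewrite unitmx_adj.
exists Z11, (Y *m Q); rewrite !castmx_id; split => //; rewrite Z11Q.
  rewrite /symplectic /Jmx adjmx_block !mulmx_block !adjmx0.
  rewrite !(mulmx0, mul0mx, mulmx1, addr0, add0r, mulmxN, mulNmx).
  rewrite Z11E Z11E'' adjmxM Yh mulmxA.
  by rewrite addNr.
set Z := block_mx _ _ _ _.
have ZU : Z \in unitmx.
  by rewrite unitmxE det_ublock unitrM -!unitmxE Z11U QU.
rewrite -mulmxA; apply: (can_inj (mulKmx ZU)); rewrite mulKVmx //.
rewrite !mulmx_block !(mulmx0, mul0mx, addr0, add0r, mulmxN, mulNmx).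
have TZ : T *m Z11 = Z11 *m T'.
  have /(congr1 (fun X => X^t*)) := AQ; rewrite !adjmxM !trmxCK => e.
  by rewrite -[LHS]mul1mx -Z11E' -mulmxA [in X in _ *m X]mulmxA e -!mulmxA Z11E mulmx1.
congr block_mx => //; last by rewrite AQ.
(* [Z11 *m G'] equals [S *m Q], whose summand [Y *m T^t* *m Q] cancels against [Y *m Q *m T'^t*]. *)
rewrite -[Z11 *m G']/(Z11 *m G') -QSQ !mulmxA Z11E' mul1mx /S trmxCK.
by rewrite !mulmxDl -!mulmxA AQ addrK addrC.
Qed.

(** * Sylvester equations, observability and Lagrangian subspaces *)

Lemma conjc_imaginary (R : realType) (a : R[i]) :
  a^* = - a <-> complex.Re a = 0.
Proof.
case: a => x y; have -> : conjC (x +i* y)%C = (x -i* y)%C by [].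
split=> [[e]|/= ->]; last by apply/eqP; rewrite eq_complex /= oppr0 !eqxx.
have : x *+ 2 == 0 by rewrite mulr2n {2}e subrr.
by rewrite mulrn_eq0 => /eqP.
Qed.

(** In a full-rank factorization [Z = P *m Q], one matrix [S] satisfies both [A *m P = P *m S] and
    [Q *m B = S *m Q], so an eigenvalue of [S] is common to [A] and [B]. *)
Lemma sylvester_inj (C : numClosedFieldType) m n (A : 'M[C]_m) (B : 'M_n)
    (Z : 'M_(m, n)) :
  (forall a, eigenvalue A a -> eigenvalue B a -> False) ->
  A *m Z = Z *m B -> Z = 0.
Proof.
move=> disj AZ; apply/eqP; rewrite -mxrank_eq0 -leqn0 leqNgt; apply/negP => r0.
move: (\rank Z) r0 (rank_factorization Z) => p p0.
move=> [P [Q [PQ [P' PP] [Q' QQ]]]].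
pose S := Q *m B *m Q'.
have AP : A *m P = P *m S.
  by rewrite /S !mulmxA PQ -AZ -PQ -!mulmxA QQ mulmx1.
have QB : Q *m B = S *m Q.
  rewrite -[LHS]mul1mx -PP -mulmxA [P *m _]mulmxA PQ -AZ -PQ [A *m _]mulmxA AP.
  by rewrite !mulmxA PP mul1mx.
have [a Sa] := eigenvalue_closed S p0; apply: (disj a).
  have [x Sx xnz] := eigenvalue_colP _ _ Sa; apply/eigenvalue_colP.
  exists (P *m x); first by rewrite mulmxA AP -mulmxA Sx -scalemxAr.
  apply: contra_neq xnz => e; have := congr1 (mulmx P') e.
  by rewrite mulmxA PP mul1mx mulmx0.
have [x Sx xnz] := eigenvalueP Sa; apply/eigenvalueP.
exists (x *m Q); first by rewrite -mulmxA QB mulmxA Sx -scalemxAl.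
apply: contra_neq xnz => e; have := congr1 (mulmx^~ Q') e.
by rewrite -mulmxA QQ mulmx1 mul0mx.
Qed.

(** By [sylvester_inj] the Sylvester operator is injective on a finite-dimensional space, hence
    invertible. *)
Lemma sylvester_unique (C : numClosedFieldType) m n (A : 'M[C]_m) (B : 'M_n) D :
  (forall a, eigenvalue A a -> eigenvalue (- B) a -> False) ->
  exists Z : 'M_(m, n), unique (fun Z => A *m Z + Z *m B + D = 0) Z.
Proof.
move=> disj.
pose M : 'M[C]_(m * n) := lin_mx (mulmx A) + lin_mx (mulmxr B).
have ME (Z : 'M_(m, n)) : mxvec Z *m M = mxvec (A *m Z + Z *m B).
  by rewrite mulmxDr !mul_vec_lin /= -linearD.
have inj (Z : 'M_(m, n)) : A *m Z + Z *m B = 0 -> Z = 0.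
  by move=> /eqP; rewrite addr_eq0 -mulmxN => /eqP; apply: sylvester_inj.
have MU : M \in unitmx.
  rewrite -row_free_unit -kermx_eq0; apply/rowV0P => v /sub_kermxP vM.
  by rewrite -[v]vec_mxK [X in mxvec X](inj (vec_mx v)) ?linear0 //;
    apply: (can_inj mxvecK); rewrite -ME vec_mxK vM linear0.
exists (vec_mx (- mxvec D *m invmx M)); split.
  apply/eqP; rewrite addr_eq0; apply/eqP; apply: (can_inj mxvecK).
  by rewrite -ME vec_mxK mulmxKV // linearN.
move=> Z eZ; apply: (can_inj mxvecK); rewrite vec_mxK.
apply: (can_inj (mulmxK MU)); rewrite mulmxKV // ME -linearN; congr mxvec.
by apply/eqP; rewrite eq_sym -addr_eq0 eZ.
Qed.

(** The adjoint of [x] is a left null vector of the pencil at [a^*], which has full row rank. *)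
Lemma controllable_observable (C : numClosedFieldType) n m (F : 'M[C]_n)
    (G : 'M_(n, m)) a (x : 'cV_n) :
  controllable F G -> F^t* *m x = a *: x -> G^t* *m x = 0 -> x = 0.
Proof.
move=> /(_ a^*) rk Fx Gx.
have free : row_free (row_mx (a^*%:M - F) G) by rewrite /row_free rk.
rewrite -[x]trmxCK; have -> : x^t* = 0; last by rewrite adjmx0.
apply/eqP; rewrite -(mulmx_free_eq0 _ free) mul_mx_row.
have -> : x^t* *m G = 0 by rewrite -[LHS]trmxCK adjmxM trmxCK Gx adjmx0.
rewrite mulmxBr mul_mx_scalar -adjmxZ -Fx adjmxM trmxCK subrr row_mx0.
by [].
Qed.

Lemma psdmx_congr (C : numClosedFieldType) m n (G : 'M[C]_n) (P : 'M_(m, n)) :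
  psdmx G -> psdmx (P *m G *m P^t*).
Proof.
move=> [/hermsymmxP Gh Gp]; split.
  by apply/hermsymmxP; rewrite !adjmxM trmxCK Gh mulmxA.
by move=> v; have := Gp (P^t* *m v); rewrite adjmxM trmxCK !mulmxA.
Qed.

Lemma psdmx_ulsub (C : numClosedFieldType) n1 n2 (A : 'M[C]_n1)
    (B : 'M_(n1, n2)) D (E : 'M_n2) :
  psdmx (block_mx A B D E) -> psdmx A.
Proof.
move/(psdmx_congr (row_mx 1%:M 0 : 'M_(n1, n1 + n2))).
rewrite tr_row_mx map_col_mx mul_row_block mul_row_col adjmx1 adjmx0.
by rewrite !(mul1mx, mul0mx, mulmx1, mulmx0, addr0).
Qed.

Lemma psdmx_drsub (C : numClosedFieldType) n1 n2 (A : 'M[C]_n1)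
    (B : 'M_(n1, n2)) D (E : 'M_n2) :
  psdmx (block_mx A B D E) -> psdmx E.
Proof.
move/(psdmx_congr (row_mx 0 1%:M : 'M_(n2, n1 + n2))).
rewrite tr_row_mx map_col_mx mul_row_block mul_row_col adjmx1 adjmx0.
by rewrite !(mul1mx, mul0mx, mulmx1, mulmx0, add0r).
Qed.

(** If [U1 *m x = 0], isotropy and semidefiniteness give [G *m (U2 *m x) = 0], so the kernel of [U1]
    is stable under [S]. For an eigenvector [x] of [S] in it, observability forces [U2 *m x = 0],
    against the rank. Isotropy then makes [X] Hermitian, and invariance gives its Riccati
    equation. *)
Lemma lagrangian_graph (C : numClosedFieldType) m (T G U1 U2 : 'M[C]_m) :
  psdmx G ->
  (forall a (x : 'cV_m), T^t* *m x = a *: x -> G *m x = 0 -> x = 0) ->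
  lagrangian_invariant (block_mx T G 0 (- T^t*)) (col_mx U1 U2) ->
  let X := U2 *m invmx U1 in
  [/\ U1 \in unitmx, X^t* = X & T^t* *m X + X *m T + X *m G *m X = 0].
Proof.
move=> Gpsd obs [rkU [S]]; have [/hermsymmxP Gh _] := Gpsd.
rewrite mul_block_col mul_col_mx => /eq_col_mx[].
rewrite mul0mx add0r mulNmx => e1 e2.
rewrite adjmx_col mul_row_block mul_row_col.
rewrite !(mulmx0, mul0mx, add0r, addr0, mulmx1, mulmxN, mulNmx) => e3 X.
have U12 : U1^t* *m U2 = U2^t* *m U1.
  by move/eqP: e3; rewrite addrC subr_eq0 => /eqP.
have Uinj (x : 'cV_m) : U1 *m x = 0 -> U2 *m x = 0 -> x = 0.
  have free : row_free (col_mx U1 U2)^T by rewrite /row_free mxrank_tr rkU.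
  move=> z1 z2; apply: trmx_inj; rewrite trmx0; apply/eqP.
  by rewrite -(mulmx_free_eq0 _ free) -trmx_mul mul_col_mx z1 z2 col_mx0 trmx0.
have stab (x : 'cV_m) : U1 *m x = 0 -> G *m (U2 *m x) = 0.
  move=> z; apply: psdmx_ker => //.
  have : x^t* *m U2^t* *m (T *m U1 + G *m U2) *m x = 0.
    rewrite e1 !mulmxA -[_ *m U2^t* *m U1]mulmxA -U12 mulmxA -adjmxM z adjmx0.
    by rewrite !mul0mx.
  rewrite mulmxDr mulmxDl !mulmxA -[_ *m U1 *m x]mulmxA z mulmx0 add0r => e.
  by rewrite adjmxM.
have U1U : U1 \in unitmx.
  have [V VU] : exists V, V *m U1 = 1%:M.
    apply: injmx_left_inverse => x0 z0; apply/eqP/negPn/negP => nz.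
    have [|a [x [xnz z Sx]]] := @kernel_eigenvector _ _ _ U1 S x0 _ z0 nz.
      move=> x z; rewrite mulmxA -e1 mulmxDl -!mulmxA z mulmx0 add0r.
      exact: stab.
    case/eqP: xnz; apply: Uinj => //; apply: (obs (- a)); last exact: stab.
    by rewrite scaleNr scalemxAr -Sx [in RHS]mulmxA -e2 mulNmx opprK mulmxA.
  by have [] := mulmx1_unit VU.
have XU : X *m U1 = U2 by rewrite mulmxKV.
clearbody X.
have Xh : X^t* = X.
  apply: (can_inj (mulmxK U1U)); rewrite XU.
  have U1a : U1^t* \in unitmx by rewrite unitmx_adj.
  apply: (can_inj (mulKmx U1a)); rewrite U12 mulmxA -adjmxM XU.
  by [].
split=> //; apply: (can_inj (mulmxK U1U)); rewrite mul0mx !mulmxDl.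
rewrite -!mulmxA XU -addrA -mulmxDr e1 mulmxA XU -e2.
by rewrite subrr.
Qed.

(** * Similarity and Riccati equations *)

Lemma mx_similar_trans (C : numClosedFieldType) m n p
    (A : 'M[C]_m) (B : 'M_n) (D : 'M_p) :
  mx_similar A B -> mx_similar B D -> mx_similar A D.
Proof.
move=> [P [Q [PQ QP e]]] [P' [Q' [PQ' QP' e']]].
exists (P *m P'), (Q' *m Q); split; last by rewrite -e' -e !mulmxA.
  by rewrite mulmxA -[P *m P' *m Q']mulmxA PQ' mulmx1.
by rewrite mulmxA -[Q' *m Q *m P]mulmxA QP mulmx1.
Qed.

Lemma mx_similar_unit (C : numClosedFieldType) n (A B W : 'M[C]_n) :
  W \in unitmx -> invmx W *m A *m W = B -> mx_similar A B.
Proof. by move=> WU <-; exists W, (invmx W); rewrite mulmxV ?mulVmx. Qed.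

Lemma mx_similar_diag_block (C : numClosedFieldType) m n p
    (A : 'M[C]_m) (B : 'M_n) (D : 'M_p) :
  mx_similar A B -> mx_similar (block_mx A 0 0 D) (block_mx B 0 0 D).
Proof.
move=> [P [Q [PQ QP <-]]].
exists (block_mx P 0 0 1%:M), (block_mx Q 0 0 1%:M).
by rewrite !mulmx_block !(mulmx0, mul0mx, addr0, add0r, mulmx1, mul1mx) PQ QP
  -!scalar_mx_block.
Qed.

(** The similarity only permutes the four block coordinates. *)
Lemma mx_similar_interleave (C : numClosedFieldType) n1 n2
    (A1 B1 D1 E1 : 'M[C]_n1) (A2 B2 D2 E2 : 'M[C]_n2) :
  mx_similar
    (block_mx (block_mx A1 0 0 A2) (block_mx B1 0 0 B2)
              (block_mx D1 0 0 D2) (block_mx E1 0 0 E2))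
    (block_mx (block_mx A2 B2 D2 E2) 0 0 (block_mx A1 B1 D1 E1)).
Proof.
exists (block_mx (block_mx 0 0 1%:M 0) (block_mx 1%:M 0 0 0)
                 (block_mx 0 0 0 1%:M) (block_mx 0 1%:M 0 0)),
       (block_mx (block_mx 0 1%:M 0 0) (block_mx 0 0 0 1%:M)
                 (block_mx 1%:M 0 0 0) (block_mx 0 0 1%:M 0)).
by split; rewrite !(mulmx_block, add_block_mx, mulmx0, mul0mx, addr0, add0r,
  mulmx1, mul1mx, block_mx0) // -?scalar_mx_block.
Qed.

Lemma mx_similar_eigenvalue (C : numClosedFieldType) m n
    (A : 'M[C]_m) (B : 'M_n) a :
  mx_similar A B -> eigenvalue B a -> eigenvalue A a.
Proof.
move=> [P [Q [PQ QP e]]] /eigenvalue_colP[x Bx xnz]; apply/eigenvalue_colP.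
exists (P *m x).
  by rewrite -[LHS]mul1mx -PQ -mulmxA [in Q *m _]mulmxA mulmxA e Bx scalemxAr.
apply: contra_neq xnz => e0; have := congr1 (mulmx Q) e0.
by rewrite mulmxA QP mul1mx mulmx0.
Qed.

Lemma eigenvalue_ublock (C : numClosedFieldType) m n (A : 'M[C]_m)
    (B : 'M_(m, n)) (D : 'M_n) a :
  eigenvalue (block_mx A B 0 D) a -> eigenvalue A a \/ eigenvalue D a.
Proof.
case/eigenvalue_colP => z; rewrite -[z]vsubmxK mul_block_col scale_col_mx.
move=> /eq_col_mx[]; rewrite mul0mx add0r => e1 e2 nz.
case: (eqVneq (dsubmx z) 0) => [z0|nz2].
  left; apply/eigenvalue_colP; exists (usubmx z).
    by rewrite -e1 z0 mulmx0 addr0.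
  by apply: contra_neq nz => u0; rewrite u0 z0 col_mx0.
by right; apply/eigenvalue_colP; exists (dsubmx z).
Qed.

Lemma eigenvalue_ulblock (C : numClosedFieldType) m n (A : 'M[C]_m)
    (D : 'M_n) a : eigenvalue A a -> eigenvalue (block_mx A 0 0 D) a.
Proof.
case/eigenvalue_colP => x e nz; apply/eigenvalue_colP; exists (col_mx x 0).
  by rewrite mul_block_col !mulmx0 mul0mx !addr0 e scale_col_mx scaler0.
by apply: contra_neq nz => /eqP; rewrite col_mx_eq0 => /andP[/eqP].
Qed.

Lemma eigenvalue_opp (C : numClosedFieldType) n (A : 'M[C]_n) a :
  eigenvalue (- A) a -> eigenvalue A (- a).
Proof.
case/eigenvalue_colP => x e nz; apply/eigenvalue_colP; exists x => //.
by rewrite scaleNr -e mulNmx opprK.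
Qed.

Lemma eigenvalue_mxdiag_jordan (C : numClosedFieldType) r (k : 'I_r -> nat)
    (l : 'I_r -> C) j : (0 < k j)%N ->
  eigenvalue (\mxdiag_(j < r) jordan_block (k j) (l j)) (l j).
Proof.
move=> k0; apply/eigenvalue_colP; exists (block_delta C k j 0).
  by rewrite mul_jordan_delta //= addr0.
apply/eqP => /colP/(_ (tagnat.Rank j (Ordinal k0))).
rewrite (block_deltaE _ (Ordinal k0)) !mxE !eqxx => /eqP.
by rewrite oner_eq0.
Qed.

(** The lower left block of the identity is the Riccati equation for [X]. *)
Lemma hamiltonian_riccati_shift (C : numClosedFieldType) n
    (F G K X : 'M[C]_n) :
  riccati_solution F G K X -> G^t* = G ->
  let L := block_mx 1%:M 0 X 1%:M in let A := F + G *m X in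
  riccati_hamiltonian F G K *m L = L *m block_mx A G 0 (- A^t*).
Proof.
move=> [/hermsymmxP Xh ric] Gh /=.
rewrite /riccati_hamiltonian !mulmx_block.
rewrite !(mulmx0, mul0mx, addr0, add0r, mulmx1, mul1mx); congr block_mx.
  move/eqP: ric; rewrite addr_eq0 => /eqP <-; rewrite mulNmx mulmxDr.
  by rewrite addrC -!addrA addKr mulmxA.
by rewrite adjmxD adjmxM Gh Xh opprD addrCA subrr addr0.
Qed.

(** In the original coordinates [y] becomes [x] with [G *m x = 0]; this removes the feedback term,
    and controllability of [F] and [G] applies to [x]. *)
Lemma feedback_observable (C : numClosedFieldType) n (F G X M : 'M[C]_n) :
  controllable F G -> G^t* = G -> X^t* = X -> M \in unitmx ->
  forall a (y : 'cV_n), (invmx M *m (F + G *m X) *m M)^t* *m y = a *: y ->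
    (invmx M *m G *m (invmx M)^t* ) *m y = 0 -> y = 0.
Proof.
move=> ctrl Gh Xh MU a y Ty Gy; pose x := (invmx M)^t* *m y.
have MaM : M^t* *m (invmx M)^t* = 1%:M by rewrite -adjmxM mulVmx ?adjmx1.
have yE : y = M^t* *m x by rewrite mulmxA MaM mul1mx.
have Gx : G *m x = 0.
  have := congr1 (mulmx M) Gy.
  by rewrite mulmx0 !mulmxA mulmxV // mul1mx -mulmxA.
rewrite yE (controllable_observable (a := a) ctrl (x := x)) ?mulmx0 //; last first.
  by rewrite Gh.
have -> : F^t* *m x = (F + G *m X)^t* *m x.
  by rewrite adjmxD adjmxM Gh Xh mulmxDl -mulmxA Gx mulmx0 addr0.
rewrite {2}/x scalemxAr -Ty [in RHS]mulmxA -adjmxM mulmxK // adjmxM.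
by rewrite -mulmxA.
Qed.

Lemma riccati_solutionD (C : numClosedFieldType) n (F G K X D : 'M[C]_n) :
  riccati_solution F G K X -> G^t* = G -> D^t* = D ->
  (F + G *m X)^t* *m D + D *m (F + G *m X) + D *m G *m D = 0 ->
  riccati_solution F G K (X + D).
Proof.
move=> [/hermsymmxP Xh ric] Gh Dh; rewrite adjmxD adjmxM Gh Xh => e; split.
  by apply/hermsymmxP; rewrite adjmxD Xh Dh.
rewrite -[RHS]addr0 -{2}e -ric !(mulmxDl, mulmxDr) !mulmxA.
set a1 := F^t* *m X; set a2 := F^t* *m D; set a3 := X *m F; set a4 := D *m F.
set a5 := X *m G *m X; set a6 := D *m G *m X; set a7 := X *m G *m D.
set a8 := D *m G *m D; clear.
apply/matrixP => i j; rewrite !mxE; ring.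
Qed.

Lemma riccati_congr (C : numClosedFieldType) n (A G D M : 'M[C]_n) :
  M \in unitmx ->
  let V := (invmx M)^t* *m D *m invmx M in
  let A' := invmx M *m A *m M in let G' := invmx M *m G *m (invmx M)^t* in
  A^t* *m V + V *m A + V *m G *m V =
  (invmx M)^t* *m (A'^t* *m D + D *m A' + D *m G' *m D) *m invmx M.
Proof.
move=> MU V A' G'.
have AM : invmx M *m A = A' *m invmx M by rewrite mulmxK.
have AaM : A^t* *m (invmx M)^t* = (invmx M)^t* *m A'^t* by rewrite -!adjmxM AM.
rewrite /V !mulmxA AaM -[_ *m invmx M *m A]mulmxA AM.
by rewrite !(mulmxDl, mulmxDr) !mulmxA.
Qed.

Lemma hamiltonian_congr (C : numClosedFieldType) n (A G M : 'M[C]_n) :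
  M \in unitmx ->
  let A' := invmx M *m A *m M in let G' := invmx M *m G *m (invmx M)^t* in
  let S := block_mx M 0 0 ((invmx M)^t* ) in
  block_mx A G 0 (- A^t* ) *m S = S *m block_mx A' G' 0 (- A'^t* ).
Proof.
move=> MU A' G' S; have AaM : A^t* *m (invmx M)^t* = (invmx M)^t* *m A'^t*.
  by rewrite -!adjmxM mulmxK.
rewrite !mulmx_block !(mulmx0, mul0mx, addr0, add0r, mulNmx, mulmxN) AaM.
by rewrite /A' /G' -!mulmxA !mulKVmx.
Qed.

Lemma hamiltonian_sylvester (C : numClosedFieldType) n (A G D Z : 'M[C]_n) :
  A *m Z + Z *m A^t* + G = D ->
  let S := block_mx 1%:M Z 0 1%:M in
  block_mx A G 0 (- A^t* ) *m S = S *m block_mx A D 0 (- A^t* ).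
Proof.
move=> <- S; rewrite !mulmx_block.
rewrite !(mulmx1, mul1mx, mul0mx, mulmx0, addr0, add0r) mulmxN.
by rewrite [X in _ = block_mx _ (X - _) _ _]addrAC addrK.
Qed.

Lemma riccati_block (C : numClosedFieldType) n1 n2 (T1 X G11 : 'M[C]_n1)
    (T2 G22 : 'M_n2) G12 G21 :
  let T := block_mx T1 0 0 T2 in let G := block_mx G11 G12 G21 G22 in
  let D := block_mx X 0 0 0 in
  T^t* *m D + D *m T + D *m G *m D =
  block_mx (T1^t* *m X + X *m T1 + X *m G11 *m X) 0 0 0.
Proof.
rewrite /= adjmx_block !adjmx0 !mulmx_block !add_block_mx.
by rewrite !(mulmx0, mul0mx, addr0, add0r).
Qed.

Theorem theorem3p1 (R : realType) (n1 n2 : nat)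
    (F G K X0 M : 'M[R[i]]_(n1 + n2))
    (T1 G11 : 'M[R[i]]_n1) (T2 G22 : 'M[R[i]]_n2) (G21 : 'M[R[i]]_(n2, n1))
    (G_psd : psdmx G) (K_psd : psdmx K)
    (FG_controllable : controllable F G)
    (X0_sol : riccati_solution F G K X0)
    (M_unit : M \in unitmx)
    (M_diag : invmx M *m (F + G *m X0) *m M = block_mx T1 0 0 T2)
    (T1_eig : forall a : R[i], eigenvalue T1 a -> complex.Re a != 0)
    (T2_eig : forall a : R[i], eigenvalue T2 a -> complex.Re a = 0)
    (G_part : invmx M *m G *m (invmx M)^t* = block_mx G11 (G21^t* ) G21 G22) :
  let H := riccati_hamiltonian F G K in
  let H2 := block_mx T2 G22 0 (- T2^t* ) in
  [/\ (* the Sylvester equation is uniquely solvable, and its solution yields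
         the block form of H *)
      exists2 Z12 : 'M[R[i]]_(n1, n2),
        unique (fun Z => T1 *m Z + Z *m T2^t* + G21^t* = 0) Z12 &
        let S : 'M[R[i]]_((n1 + n2) + (n1 + n2)) :=
          block_mx M 0 0 ((invmx M)^t* ) *m
          block_mx 1%:M (block_mx 0 Z12 (Z12^t* ) 0) 0 1%:M in
        let W := block_mx 1%:M 0 X0 1%:M *m S in
        W \in unitmx /\
        invmx W *m H *m W =
          block_mx (block_mx T1 0 0 T2) (block_mx G11 0 0 G22)
                   0 (block_mx (- T1^t* ) 0 0 (- T2^t* )),
      (* the condensed form of the imaginary part, and the Jordan blocks of
         the purely imaginary eigenvalues *)
      exists (r : nat) (k : 'I_r -> nat) (gamma : 'I_r -> R)
             (k_sum : (\sum_(j < r) k j)%N = n2),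
        let lambda j : R[i] := (0 +i* gamma j)%C in
        let JH := \mxdiag_(j < r) jordan_block (k j).*2 (lambda j) in
        [/\ forall j, (0 < k j)%N,
            exists Z11 Z12 : 'M[R[i]]_n2,
              let Z := block_mx Z11 Z12 0 ((invmx Z11)^t* ) in
              let T := castmx (k_sum, k_sum)
                (\mxdiag_(j < r) jordan_block (k j) (lambda j)) in
              let Gt := castmx (k_sum, k_sum)
                (\mxdiag_(j < r)
                   (last_col _ (k j) *m (last_col _ (k j))^t* )) in
              [/\ Z11 \in unitmx, symplectic Z
                & invmx Z *m H2 *m Z = block_mx T Gt 0 (- T^t* )],
            forall j, eigenvalue H2 (lambda j) /\ eigenvalue H (lambda j),
            mx_similar H2 JH
          & exists2 B : 'M[R[i]]_(n1 + n1),
              mx_similar H (block_mx JH 0 0 B) &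
              forall a : R[i], eigenvalue B a -> complex.Re a != 0]
    & (* every Lagrangian invariant subspace of the other part is a graph, and
         gives a solution *)
      forall U11 U21 : 'M[R[i]]_n1,
        lagrangian_invariant (block_mx T1 G11 0 (- T1^t* )) (col_mx U11 U21) ->
        U11 \in unitmx /\
        riccati_solution F G K
          (X0 + (invmx M)^t* *m block_mx (U21 *m invmx U11) 0 0 0 *m invmx M)].
Proof.
move=> H H2; have [/hermsymmxP Gh _] := G_psd.
have [/hermsymmxP X0h _] := X0_sol.
set A := F + G *m X0 in M_diag; set Tb := block_mx T1 0 0 T2 in M_diag.
set Gb := block_mx G11 _ _ _ in G_part.
have Gb_psd : psdmx Gb by rewrite -G_part; apply: psdmx_congr.
have G11_psd := psdmx_ulsub Gb_psd; have G22_psd := psdmx_drsub Gb_psd.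
have obs a (y : 'cV_(n1 + n2)) : Tb^t* *m y = a *: y -> Gb *m y = 0 -> y = 0.
  rewrite -M_diag -G_part.
  exact: (feedback_observable FG_controllable Gh X0h M_unit).
have Tba : Tb^t* = block_mx (T1^t*) 0 0 (T2^t*).
  by rewrite adjmx_block !adjmx0.
have obs1 a (y : 'cV_n1) : T1^t* *m y = a *: y -> G11 *m y = 0 -> y = 0.
  move=> Ty Gy; have : col_mx y (0 : 'cV_n2) = 0.
    apply: (obs a).
      by rewrite Tba mul_block_col !mulmx0 mul0mx !addr0 Ty scale_col_mx scaler0.
    (* [G11 *m y = 0] makes the form of [Gb] vanish at the padded vector; [psdmx_ker] then puts that
       vector in the kernel. *)
    apply: psdmx_ker => //; rewrite adjmx_col mul_row_block mul_row_col.
    by rewrite adjmx0 !(mul0mx, mulmx0, addr0) -mulmxA Gy mulmx0.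
  by move/eqP; rewrite col_mx_eq0 => /andP[/eqP].
have obs2 a (y : 'cV_n2) : T2^t* *m y = a *: y -> G22 *m y = 0 -> y = 0.
  move=> Ty Gy; have : col_mx (0 : 'cV_n1) y = 0.
    apply: (obs a).
      by rewrite Tba mul_block_col !mulmx0 mul0mx !add0r Ty scale_col_mx scaler0.
    apply: psdmx_ker => //; rewrite adjmx_col mul_row_block mul_row_col.
    by rewrite adjmx0 !(mul0mx, mulmx0, add0r) -mulmxA Gy mulmx0.
  by move/eqP; rewrite col_mx_eq0 => /andP[_ /eqP].
have T2_im a : eigenvalue T2 a -> a^* = - a.
  by move/T2_eig => e; apply/conjc_imaginary.
have T1_nim a : eigenvalue T1 a -> a^* = - a -> False.
  by move=> /T1_eig /eqP ne /conjc_imaginary.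
(* The eigenvalues of [- T2^t*] are imaginary, hence disjoint from those of [T1]. *)
have [|Z12 Z12P] := @sylvester_unique _ _ _ T1 (T2^t*) (G21^t*).
  move=> a Ta /eigenvalue_opp/eigenvalue_adj/T2_im; rewrite conjCK rmorphN /=.
  by rewrite opprK => e; apply: T1_nim Ta (esym e).
set S := block_mx M 0 0 ((invmx M)^t* ) *m
  block_mx 1%:M (block_mx 0 Z12 (Z12^t* ) 0) 0 1%:M.
set W := block_mx 1%:M 0 X0 1%:M *m S.
set HT := block_mx Tb (block_mx G11 0 0 G22)
  0 (block_mx (- T1^t* ) 0 0 (- T2^t* )).
have WU : W \in unitmx.
  rewrite !unitmx_mul !unitmxE det_lblock !det_ublock !det1 !mulr1 unitr1 ?andbT /=.
  by rewrite unitrM -!unitmxE unitmx_adj unitmx_inv M_unit.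
(* The off-diagonal blocks of this identity are the Sylvester equation and its adjoint. *)
have Syl : Tb *m block_mx 0 Z12 (Z12^t* ) 0 + block_mx 0 Z12 (Z12^t* ) 0 *m Tb^t* +
    Gb = block_mx G11 0 0 G22.
  have [e _] := Z12P; have := congr1 (fun X => X^t*) e.
  rewrite adjmx0 !adjmxD !adjmxM !trmxCK => e'.
  rewrite Tba !mulmx_block !add_block_mx !(mulmx0, mul0mx, addr0, add0r) e.
  by congr block_mx; rewrite [T2 *m _ + _]addrC e'.
have HW : invmx W *m H *m W = HT.
  rewrite -mulmxA; apply: (can_inj (mulKmx WU)); rewrite mulKVmx //.
  rewrite /W mulmxA (hamiltonian_riccati_shift X0_sol Gh) -/A.
  rewrite -mulmxA -[RHS]mulmxA; congr (_ *m _).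
  rewrite /S mulmxA hamiltonian_congr // M_diag G_part -mulmxA -[RHS]mulmxA.
  congr (_ *m _); have -> : HT = block_mx Tb (block_mx G11 0 0 G22) 0 (- Tb^t* ).
    by rewrite /HT Tba opp_block_mx !oppr0.
  exact: hamiltonian_sylvester.
have HHT : mx_similar H HT by apply: mx_similar_unit WU HW.
split.
- by exists Z12.
- have [r [k [l [k_sum [k0 lI [Z11 [Z12' [Z11U Zs Ze]]]]]]]] :=
    condensed_form G22_psd T2_im obs2.
  pose gamma j := complex.Im (l j).
  have lE : l =1 (fun j => (0 +i* gamma j)%C).
    move=> j; have /conjc_imaginary := lI j; rewrite /gamma.
    by case: (l j) => x y /= ->.
  exists r, k, gamma, k_sum => lambda JH.
  have TE : \mxdiag_(j < r) jordan_block (k j) (lambda j) =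
            \mxdiag_(j < r) jordan_block (k j) (l j).
    by apply: eq_mxdiag => j; rewrite lE.
  have JE : JH = \mxdiag_(j < r) jordan_block (k j).*2 (l j).
    by apply: eq_mxdiag => j; rewrite lE.
  have H2JH : mx_similar H2 JH.
    rewrite JE; apply: mx_similar_trans (condensed_similar k_sum k0 lI).
    apply: mx_similar_unit Ze; rewrite unitmxE det_ublock unitrM -!unitmxE.
    by rewrite Z11U unitmx_adj unitmx_inv.
  (* Interleaving separates the [T2] part, replaced by [JH], from the [T1] part. *)
  have HJH : mx_similar H (block_mx JH 0 0 (block_mx T1 G11 0 (- T1^t*))).
    apply: mx_similar_trans HHT _.
    apply: mx_similar_trans (mx_similar_diag_block _ H2JH).
    have := mx_similar_interleave T1 G11 0 (- T1^t*) T2 G22 0 (- T2^t*).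
    by rewrite !block_mx0.
  have JHe j : eigenvalue JH (lambda j).
    by rewrite JE -[lambda j]lE; apply: eigenvalue_mxdiag_jordan; rewrite double_gt0.
  split=> //.
  + by exists Z11, Z12'; rewrite TE.
  + move=> j; split; first exact: mx_similar_eigenvalue H2JH (JHe j).
    exact: mx_similar_eigenvalue HJH (eigenvalue_ulblock _ (JHe j)).
  (* The eigenvalues of this block come from [T1] and [- T1^t*], and both avoid the imaginary
     axis. *)
  + exists (block_mx T1 G11 0 (- T1^t*)) => // a.
    case/eigenvalue_ublock => [/T1_eig //|/eigenvalue_opp/eigenvalue_adj Ta].
    apply/eqP => /conjc_imaginary e; apply: T1_nim Ta _.
    by rewrite rmorphN /= e opprK e.
- move=> U11 U21 lag.
  have [U11U Xh Xric] := lagrangian_graph G11_psd obs1 lag.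
  split; first exact: U11U.
  set X := U21 *m invmx U11 in Xh Xric *.
  apply: (riccati_solutionD X0_sol Gh).
    by rewrite !adjmxM trmxCK adjmx_block Xh !adjmx0 mulmxA.
  rewrite riccati_congr // M_diag G_part riccati_block Xric block_mx0.
  by rewrite mulmx0 mul0mx.
Qed.
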